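(* If a function $f:\{0,1\}^*\to\{0,1\}$ is computable in time $n^{2^d}$ (where $n$ is the input length) by a one-tape alternating Turing machine, for some $d\in\mathbb{N}$, then there exists a term $M$ of $\Lambda_B$ such that $;\vdash M:\mathbf{W}\Rightarrow\S^{2d+2}\mathbf{Bool}$ is derivable in $\mathbf{DLAL_B}$ and $M$ represents $f$, i.e. for every $w\in\{0,1\}^*$ the $\beta\delta$-normal form of $M\,\underline{w}$ is $T$ if $f(w)=1$ and $F$ if $f(w)=0$.
   Context: System $\mathbf{DLAL_B}$. Types: $A,B::=\alpha\mid A\multimap B\mid A\Rightarrow B\mid \S A\mid \forall\alpha.A\mid \mathbf{Bool}$. Terms of $\Lambda_B$: $t,u,v::=x\mid F\mid T\mid \lambda x.t\mid t\,u\mid \mathrm{if}\ t\ \mathrm{then}\ u\ \mathrm{else}\ v$. Besides $\beta$-reduction there is $\delta$-reduction, the contextual closure of $(\mathrm{if}\ T\ \mathrm{then}\ u\ \mathrm{else}\ v)\to u$ and $(\mathrm{if}\ F\ \mathrm{then}\ u\ \mathrm{else}\ v)\to v$. Judgements are $\Gamma;\Delta\vdash t:A$ where $\Gamma$ (non-linear) and $\Delta$ (linear) assign types to distinct variables, with disjoint domains. Rules: (Id) $;x:A\vdash x:A$. ($\multimap$i) from $\Gamma;\Delta,x:A\vdash t:B$ infer $\Gamma;\Delta\vdash\lambda x.t:A\multimap B$. ($\multimap$e) from $\Gamma_1;\Delta_1\vdash t:A\multimap B$ and $\Gamma_2;\Delta_2\vdash u:A$ infer $\Gamma_1,\Gamma_2;\Delta_1,\Delta_2\vdash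 t\,u:B$. ($\Rightarrow$i) from $\Gamma,x:A;\Delta\vdash t:B$ infer $\Gamma;\Delta\vdash \lambda x.t:A\Rightarrow B$. ($\Rightarrow$e) from $\Gamma;\Delta\vdash t:A\Rightarrow B$ and $;z:C\vdash u:A$ infer $\Gamma,z:C;\Delta\vdash t\,u:B$ (the right premise may also be $;\vdash u:A$, with conclusion $\Gamma;\Delta\vdash t\,u:B$). (Weak) from $\Gamma_1;\Delta_1\vdash t:A$ infer $\Gamma_1,\Gamma_2;\Delta_1,\Delta_2\vdash t:A$. (Cntr) from $x_1:A,x_2:A,\Gamma;\Delta\vdash t:B$ infer $x:A,\Gamma;\Delta\vdash t[x/x_1,x/x_2]:B$. ($\S$i) from $;\Gamma,\Delta\vdash t:A$ infer $\Gamma;\S\Delta\vdash t:\S A$ ($\S\Delta$ prefixes $\S$ to every type of $\Delta$). ($\S$e) from $\Gamma_1;\Delta_1\vdash u:\S A$ and $\Gamma_2;x:\S A,\Delta_2\vdash t:B$ infer $\Gamma_1,\Gamma_2;\Delta_1,\Delta_2\vdash t[u/x]:B$. ($\forall$i) from $\Gamma;\Delta\vdash t:A$ infer $\Gamma;\Delta\vdash t:\forall\alpha.A$ if $\alpha$ is not free in $\Gamma,\Delta$. ($\forall$e) from $\Gamma;\Delta\vdash t:\forall\alpha.A$ infer $\Gamma;\Delta\vdash t:A[B/\alpha]$. ($B_0$i) $;\vdash F:\mathbf{Bool}$; ($B_1$i) $;\vdash T:\mathbf{Bool}$. ($B$e) from $\Gamma;\Delta\vdash M_0:\S^k\mathbf{Bool}$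 ($k\in\mathbb{N}$), $\Gamma;\Delta\vdash M_1:A$, $\Gamma;\Delta\vdash M_2:A$ infer $\Gamma;\Delta\vdash \mathrm{if}\ M_0\ \mathrm{then}\ M_1\ \mathrm{else}\ M_2:A$. Binary words: $\mathbf{W}=\forall\alpha.(\alpha\multimap\alpha)\Rightarrow(\alpha\multimap\alpha)\Rightarrow\S(\alpha\multimap\alpha)$ and for $w=i_1\cdots i_n\in\{0,1\}^*$, $\underline{w}=\lambda f_0.\lambda f_1.\lambda x.f_{i_1}(f_{i_2}(\cdots(f_{i_n}x)\cdots))$. *)

(* Defs.v *)
From HB Require Import structures.
From mathcomp Require Import all_boot.
From Stdlib Require Import Relation_Operators.
Set Implicit Arguments.
Unset Strict Implicit.
Unset Printing Implicit Defensive.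

(* Types and terms are de Bruijn terms, i.e. they are taken up to renaming of
   bound variables.  The free indices play the role of the (type or term)
   variable names: contexts assign types to free indices, and the binders of
   the calculus, forall alpha.A and lambda x.t, are recovered as the operations
   [tforall] and [abs] below, which bind a given free variable. *)

Inductive type : Type :=
| TVar of nat
| Lolli of type & type
| Arrow of type & type
| Par of type
| Forall of type
| Boolean.

Fixpoint type_eqb (A B : type) : bool :=
  match A, B with
  | TVar m, TVar n => m == n
  | Lolli A1 A2, Lolli B1 B2 => type_eqb A1 B1 && type_eqb A2 B2
  | Arrow A1 A2, Arrow B1 B2 => type_eqb A1 B1 && type_eqb A2 B2
  | Par A1, Par B1 => type_eqb A1 B1
  | Forall A1, Forall B1 => type_eqb A1 B1
  | Boolean, Boolean => true
  | _, _ => false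
  end.

Lemma type_eqP : Equality.axiom type_eqb.
Proof.
move=> A B; apply: (iffP idP) => [|<-]; last first.
  by elim: A => //= [A1 -> A2 ->|A1 -> A2 ->].
elim: A B => [m|A1 IH1 A2 IH2|A1 IH1 A2 IH2|A1 IH1|A1 IH1|]
             [n|B1 B2|B1 B2|B1|B1|] //=.
- by move/eqP ->.
- by case/andP => /IH1 -> /IH2 ->.
- by case/andP => /IH1 -> /IH2 ->.
- by move/IH1 ->.
- by move/IH1 ->.
Qed.

HB.instance Definition _ := hasDecEq.Build type type_eqP.

Definition up_ren (r : nat -> nat) (n : nat) : nat :=
  if n is m.+1 then (r m).+1 else 0.

(* The renaming under which a body whose variable x gets bound is read. *)
Definition bind_ren (x n : nat) : nat := if n == x then 0 else n.+1.

Fixpoint tren (r : nat -> nat) (A : type) : type :=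
  match A with
  | TVar n => TVar (r n)
  | Lolli B C => Lolli (tren r B) (tren r C)
  | Arrow B C => Arrow (tren r B) (tren r C)
  | Par B => Par (tren r B)
  | Forall B => Forall (tren (up_ren r) B)
  | Boolean => Boolean
  end.

Definition tup (s : nat -> type) (n : nat) : type :=
  if n is m.+1 then tren S (s m) else TVar 0.

Fixpoint tsubst (s : nat -> type) (A : type) : type :=
  match A with
  | TVar n => s n
  | Lolli B C => Lolli (tsubst s B) (tsubst s C)
  | Arrow B C => Arrow (tsubst s B) (tsubst s C)
  | Par B => Par (tsubst s B)
  | Forall B => Forall (tsubst (tup s) B)
  | Boolean => Boolean
  end.

(* [tinst A B] is A'[B/alpha] when Forall A stands for forall alpha.A'. *)
Definition tinst (A B : type) : type :=
  tsubst (fun n => if n is m.+1 then TVar m else B) A.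

Definition tforall (a : nat) (A : type) : type := Forall (tren (bind_ren a) A).

Fixpoint tfree (a : nat) (A : type) : bool :=
  match A with
  | TVar n => n == a
  | Lolli B C | Arrow B C => tfree a B || tfree a C
  | Par B => tfree a B
  | Forall B => tfree a.+1 B
  | Boolean => false
  end.

Inductive term : Type :=
| Var of nat
| tmF
| tmT
| Lam of term
| App of term & term
| If of term & term & term.

Fixpoint ren (r : nat -> nat) (t : term) : term :=
  match t with
  | Var n => Var (r n)
  | tmF => tmF
  | tmT => tmT
  | Lam u => Lam (ren (up_ren r) u)
  | App u v => App (ren r u) (ren r v)
  | If u v w => If (ren r u) (ren r v) (ren r w)
  end.

Definition up (s : nat -> term) (n : nat) : term :=
  if n is m.+1 then ren S (s m) else Var 0.

Fixpoint subst (s : nat -> term) (t : term) : term :=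
  match t with
  | Var n => s n
  | tmF => tmF
  | tmT => tmT
  | Lam u => Lam (subst (up s) u)
  | App u v => App (subst s u) (subst s v)
  | If u v w => If (subst s u) (subst s v) (subst s w)
  end.

(* [inst t u] is t'[u/x] when Lam t stands for lambda x.t'. *)
Definition inst (t u : term) : term :=
  subst (fun n => if n is m.+1 then Var m else u) t.

Definition abs (x : nat) (t : term) : term := Lam (ren (bind_ren x) t).

(* t[u/x], for a free variable x of t *)
Definition subst_var (u : term) (x : nat) (t : term) : term :=
  subst (fun y => if y == x then u else Var y) t.

(* t[x/x1, x/x2] *)
Definition merge_var (x x1 x2 : nat) (t : term) : term :=
  ren (fun y => if (y == x1) || (y == x2) then x else y) t.

Inductive redex : term -> term -> Prop :=
| redex_beta t u : redex (App (Lam t) u) (inst t u)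
| redex_deltaT u v : redex (If tmT u v) u
| redex_deltaF u v : redex (If tmF u v) v.

Inductive red : term -> term -> Prop :=
| red_redex t u : redex t u -> red t u
| red_Lam t t' : red t t' -> red (Lam t) (Lam t')
| red_App1 t t' u : red t t' -> red (App t u) (App t' u)
| red_App2 t u u' : red u u' -> red (App t u) (App t u')
| red_If1 t t' u v : red t t' -> red (If t u v) (If t' u v)
| red_If2 t u u' v : red u u' -> red (If t u v) (If t u' v)
| red_If3 t u v v' : red v v' -> red (If t u v) (If t u v').

Definition normal (t : term) : Prop := forall u, ~ red t u.

Definition normal_form_of (t u : term) : Prop :=
  clos_refl_trans term red t u /\ normal u.

Definition context : Type := seq (nat * type).

Definition par_ctx (D : context) : context := [seq (p.1, Par p.2) | p <- D].

Definition parn (k : nat) (A : type) : type := iter k Par A.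

Definition distinct_vars (G D : context) : bool := uniq (unzip1 (G ++ D)).

Definition not_free_in (a : nat) (G D : context) : bool :=
  all (fun p => ~~ tfree a p.2) (G ++ D).

(* [typing G D t A] is the judgement G; D |- t : A.  Contexts are finite sets
   of declarations, whence the rule [ty_exch]; [distinct_vars] is required of
   the conclusion wherever it does not follow from the premises, so that it
   holds in every derivable judgement. *)
Inductive typing : context -> context -> term -> type -> Prop :=
| ty_exch G G' D D' t A :
    perm_eq G G' -> perm_eq D D' ->
    typing G D t A ->
    typing G' D' t A
| ty_id x A :
    typing [::] [:: (x, A)] (Var x) A
| ty_lolli_i G D x A B t :
    typing G (rcons D (x, A)) t B ->
    typing G D (abs x t) (Lolli A B)
| ty_lolli_e G1 G2 D1 D2 t u A B :
    distinct_vars (G1 ++ G2) (D1 ++ D2) ->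
    typing G1 D1 t (Lolli A B) ->
    typing G2 D2 u A ->
    typing (G1 ++ G2) (D1 ++ D2) (App t u) B
| ty_arrow_i G D x A B t :
    typing (rcons G (x, A)) D t B ->
    typing G D (abs x t) (Arrow A B)
| ty_arrow_e G D z C t u A B :
    distinct_vars (rcons G (z, C)) D ->
    typing G D t (Arrow A B) ->
    typing [::] [:: (z, C)] u A ->
    typing (rcons G (z, C)) D (App t u) B
| ty_arrow_e0 G D t u A B :
    typing G D t (Arrow A B) ->
    typing [::] [::] u A ->
    typing G D (App t u) B
| ty_weak G1 G2 D1 D2 t A :
    distinct_vars (G1 ++ G2) (D1 ++ D2) ->
    typing G1 D1 t A ->
    typing (G1 ++ G2) (D1 ++ D2) t A
| ty_cntr G D x x1 x2 A B t :
    distinct_vars ((x, A) :: G) D ->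
    typing ((x1, A) :: (x2, A) :: G) D t B ->
    typing ((x, A) :: G) D (merge_var x x1 x2 t) B
| ty_par_i G D t A :
    typing [::] (G ++ D) t A ->
    typing G (par_ctx D) t (Par A)
| ty_par_e G1 G2 D1 D2 x t u A B :
    distinct_vars (G1 ++ G2) (D1 ++ D2) ->
    typing G1 D1 u (Par A) ->
    typing G2 ((x, Par A) :: D2) t B ->
    typing (G1 ++ G2) (D1 ++ D2) (subst_var u x t) B
| ty_forall_i G D a t A :
    not_free_in a G D ->
    typing G D t A ->
    typing G D t (tforall a A)
| ty_forall_e G D t A B :
    typing G D t (Forall A) ->
    typing G D t (tinst A B)
| ty_B0i : typing [::] [::] tmF Boolean
| ty_B1i : typing [::] [::] tmT Boolean
| ty_Be G D k t u v A :
    typing G D t (parn k Boolean) ->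
    typing G D u A ->
    typing G D v A ->
    typing G D (If t u v) A.

Definition W : type :=
  let a := TVar 0 in
  tforall 0 (Arrow (Lolli a a) (Arrow (Lolli a a) (Par (Lolli a a)))).

(* false is the letter 0 and true the letter 1; under the three abstractions
   f_0, f_1 and x are the indices 2, 1 and 0. *)
Definition word (w : seq bool) : term :=
  Lam (Lam (Lam
    (foldr (fun i t => App (Var (if i then 1 else 2)) t) (Var 0) w))).

Definition represents (M : term) (f : seq bool -> bool) : Prop :=
  forall w : seq bool,
    normal_form_of (App M (word w)) (if f w then tmT else tmF).

Inductive state_kind := Existential | Universal | Accepting | Rejecting.

Inductive move := MoveLeft | MoveRight | Stay.

Record atm : Type := Atm {
  state : finType;
  symbol : finType;
  blank : symbol;
  letter : bool -> symbol;
  letter_inj : injective letter;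
  letter_not_blank : forall b, letter b != blank;
  start : state;
  kind : state -> state_kind;
  (* [delta q s q' s' m]: in state q scanning s, the machine may write s',
     move its head as m prescribes and enter state q'. *)
  delta : state -> symbol -> state -> symbol -> move -> bool
}.

(* A two-way infinite tape: the scanned cell, and the cells on its left and on
   its right, listed from the nearest one; the cells not listed are blank. *)
Record config (M : atm) : Type := Config {
  cstate : state M;
  cleft : seq (symbol M);
  cscan : symbol M;
  cright : seq (symbol M)
}.

Definition act (M : atm) (c : config M) (q : state M) (s : symbol M)
    (m : move) : config M :=
  match m with
  | MoveLeft =>
      Config q (behead (cleft c)) (head (blank M) (cleft c)) (s :: cright c)
  | MoveRight =>
      Config q (s :: cleft c) (head (blank M) (cright c)) (behead (cright c))
  | Stay => Config q (cleft c) s (cright c)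
  end.

Definition halting_kind (k : state_kind) : bool :=
  match k with
  | Accepting | Rejecting => true
  | Existential | Universal => false
  end.

Inductive atm_step (M : atm) (c : config M) : config M -> Prop :=
| AtmStep q s m :
    halting_kind (kind (cstate c)) = false ->
    delta (cstate c) (cscan c) q s m ->
    atm_step c (act c q s m).

Inductive atm_steps (M : atm) : nat -> config M -> config M -> Prop :=
| atm_steps0 c : atm_steps 0 c c
| atm_stepsS n c c' c'' :
    atm_step c c' -> atm_steps n c' c'' -> atm_steps n.+1 c c''.

Inductive accepting (M : atm) (c : config M) : Prop :=
| accepting_halt :
    kind (cstate c) = Accepting -> accepting c
| accepting_exists c' :
    kind (cstate c) = Existential ->
    atm_step c c' -> accepting c' -> accepting c
| accepting_forall :
    kind (cstate c) = Universal ->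
    (forall c', atm_step c c' -> accepting c') -> accepting c.

Definition init_config (M : atm) (w : seq bool) : config M :=
  let tape := map (@letter M) w in
  Config (start M) [::] (head (blank M) tape) (behead tape).

(* Every computation on an input of length n has at most T n steps, and the
   accepted words are those on which f takes the value 1. *)
Definition computes_in_time (M : atm) (f : seq bool -> bool) (T : nat -> nat) :
    Prop :=
  forall w : seq bool,
    (forall k c, atm_steps k (init_config M w) c -> k <= T (size w)) /\
    (accepting (init_config M w) <-> f w = true).

(* Main.v *)
Require Import Defs.
From mathcomp Require Import all_boot.
From Stdlib Require Import Relation_Operators.
Set Implicit Arguments.
Unset Strict Implicit.
Unset Printing Implicit Defensive.

(** Since the rule for [If] shares its context between the guard and the branches,
    a boolean test consumes no resource, and functions from booleans are additive
    pairs.  A configuration is therefore a linear function from positions to cell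
    contents, tests on which are free, and acceptance within [t] steps is a function
    of type [Nat -o Conf -o Bool] which one more step of the alternating machine
    maps linearly to acceptance within [t + 1] steps: the disjunction or
    conjunction over the successors uses the same resources in every branch.
    It remains to iterate that step [n ^ (2 ^ d)] times.  Squaring a numeral has
    type [Nat -o §§Nat], so its [d]-fold iterate costs [2 d] paragraphs; the
    iteration of the step costs one, and so does the double use of the input, once
    as a clock and once as the initial tape. *)

(** * Substitution and scoping *)

Lemma up_ren_ext r r' : r =1 r' -> up_ren r =1 up_ren r'.
Proof. by move=> e [|n] //=; rewrite e. Qed.

Lemma ren_ext r r' t : r =1 r' -> ren r t = ren r' t.
Proof.
elim: t r r' => //= [n|t IH|t IHt u IHu|t IHt u IHu v IHv] r r' e.
- by rewrite e.
- by rewrite (IH _ _ (up_ren_ext e)).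
- by rewrite (IHt _ _ e) (IHu _ _ e).
- by rewrite (IHt _ _ e) (IHu _ _ e) (IHv _ _ e).
Qed.

Lemma up_ext s s' : s =1 s' -> up s =1 up s'.
Proof. by move=> e [|n] //=; rewrite e. Qed.

Lemma subst_ext s s' t : s =1 s' -> subst s t = subst s' t.
Proof.
elim: t s s' => //= [t IH|t IHt u IHu|t IHt u IHu v IHv] s s' e.
- by rewrite (IH _ _ (up_ext e)).
- by rewrite (IHt _ _ e) (IHu _ _ e).
- by rewrite (IHt _ _ e) (IHu _ _ e) (IHv _ _ e).
Qed.

Lemma ren_ren r r' t : ren r (ren r' t) = ren (r \o r') t.
Proof.
elim: t r r' => //= [t IH|t IHt u IHu|t IHt u IHu v IHv] r r'.
- by rewrite IH; congr Lam; apply: ren_ext => -[].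
- by rewrite IHt IHu.
- by rewrite IHt IHu IHv.
Qed.

Lemma subst_ren s r t : subst s (ren r t) = subst (s \o r) t.
Proof.
elim: t s r => //= [t IH|t IHt u IHu|t IHt u IHu v IHv] s r.
- by rewrite IH; congr Lam; apply: subst_ext => -[].
- by rewrite IHt IHu.
- by rewrite IHt IHu IHv.
Qed.

Lemma ren_subst r s t : ren r (subst s t) = subst (ren r \o s) t.
Proof.
elim: t r s => //= [t IH|t IHt u IHu|t IHt u IHu v IHv] r s.
- rewrite IH; congr Lam; apply: subst_ext => -[|n] //=.
  by rewrite !ren_ren; apply: ren_ext.
- by rewrite IHt IHu.
- by rewrite IHt IHu IHv.
Qed.

Lemma subst_Var t : subst Var t = t.
Proof.
elim: t => //= [t IH|t -> u ->|t -> u -> v ->] //.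
by rewrite -{2}IH; congr Lam; apply: subst_ext => -[].
Qed.

Definition under (P : pred nat) : pred nat :=
  fun n => if n is m.+1 then P m else true.

(** The free indices are constrained by a predicate instead of a bound because they serve as names:
    closed terms are the case [pred0], and terms over a context are the case of membership in its
    domain. *)
Fixpoint scoped (P : pred nat) (t : term) : bool :=
  match t with
  | Var n => P n
  | tmF | tmT => true
  | Lam u => scoped (under P) u
  | App u v => scoped P u && scoped P v
  | If u v w => [&& scoped P u, scoped P v & scoped P w]
  end.

Definition closed (t : term) : bool := scoped pred0 t.

Lemma scoped_sub (P Q : pred nat) t :
  (forall n, P n -> Q n) -> scoped P t -> scoped Q t.
Proof.
elim: t P Q => //= [n|t IH|t IHt u IHu|t IHt u IHu v IHv] P Q PQ.
- exact: PQ.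
- by apply: IH => -[|n] //=; apply: PQ.
- by case/andP=> /(IHt _ _ PQ)-> /(IHu _ _ PQ)->.
- by case/and3P=> /(IHt _ _ PQ)-> /(IHu _ _ PQ)-> /(IHv _ _ PQ)->.
Qed.

Lemma scoped_ren (P Q : pred nat) r t :
  (forall n, P n -> Q (r n)) -> scoped P t -> scoped Q (ren r t).
Proof.
elim: t P Q r => //= [n|t IH|t IHt u IHu|t IHt u IHu v IHv] P Q r PQ.
- exact: PQ.
- by apply: IH => -[|n] //=; apply: PQ.
- by case/andP=> /(IHt _ _ _ PQ)-> /(IHu _ _ _ PQ)->.
- by case/and3P=> /(IHt _ _ _ PQ)-> /(IHu _ _ _ PQ)-> /(IHv _ _ _ PQ)->.
Qed.

Lemma scoped_subst (P Q : pred nat) s t :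
  (forall n, P n -> scoped Q (s n)) -> scoped P t -> scoped Q (subst s t).
Proof.
elim: t P Q s => //= [n|t IH|t IHt u IHu|t IHt u IHu v IHv] P Q s PQ.
- exact: PQ.
- apply: IH => -[|n] //= Pn.
  by apply: (@scoped_ren Q) => //; apply: PQ.
- by case/andP=> /(IHt _ _ _ PQ)-> /(IHu _ _ _ PQ)->.
- by case/and3P=> /(IHt _ _ _ PQ)-> /(IHu _ _ _ PQ)-> /(IHv _ _ _ PQ)->.
Qed.

Lemma subst_id_on (P : pred nat) s t :
  (forall n, P n -> s n = Var n) -> scoped P t -> subst s t = t.
Proof.
elim: t P s => //= [n|t IH|t IHt u IHu|t IHt u IHu v IHv] P s Ps.
- exact: Ps.
- by move=> Pt; rewrite (IH (under P)) // => -[|n] //= Pn; rewrite Ps.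
- by case/andP=> /(IHt _ _ Ps)-> /(IHu _ _ Ps)->.
- by case/and3P=> /(IHt _ _ Ps)-> /(IHu _ _ Ps)-> /(IHv _ _ Ps)->.
Qed.

Lemma ren_as_subst r t : ren r t = subst (Var \o r) t.
Proof.
by rewrite -[in LHS](subst_Var t) ren_subst; apply: subst_ext.
Qed.

Lemma subst_closed s t : closed t -> subst s t = t.
Proof. exact: subst_id_on. Qed.

Lemma ren_closed r t : closed t -> ren r t = t.
Proof. by move=> ct; rewrite ren_as_subst subst_closed. Qed.

Lemma sv_closed u x t : closed t -> subst_var u x t = t.
Proof. exact: subst_closed. Qed.

Lemma closed_scoped P t : closed t -> scoped P t.
Proof. exact: scoped_sub. Qed.

(** A closed [u] is unchanged by the shift under the binder, so nothing can be captured. *)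
Lemma sv_abs u x y t : closed u -> (y == x) = false ->
  subst_var u x (abs y t) = abs y (subst_var u x t).
Proof.
move=> cu yx; rewrite /subst_var /abs /= subst_ren ren_subst.
congr Lam; apply: subst_ext => n /=; rewrite /bind_ren.
case: (n =P y) => [->|/eqP/negbTE ny] /=; first by rewrite yx /= eqxx.
by case: (n == x) => //=; rewrite ?ny // !ren_closed.
Qed.

Lemma sv_App u x a b :
  subst_var u x (App a b) = App (subst_var u x a) (subst_var u x b).
Proof. by []. Qed.

Lemma sv_If u x a b c : subst_var u x (If a b c) =
  If (subst_var u x a) (subst_var u x b) (subst_var u x c).
Proof. by []. Qed.

Lemma sv_Var u x y : subst_var u x (Var y) = if y == x then u else Var y.
Proof. by []. Qed.

Lemma sv_T u x : subst_var u x tmT = tmT.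
Proof. by []. Qed.

Lemma sv_F u x : subst_var u x tmF = tmF.
Proof. by []. Qed.

Definition svE := (sv_App, sv_If, sv_Var, sv_T, sv_F).

(** * Derived typing rules *)

Lemma unzip1_par_ctx D : unzip1 (par_ctx D) = unzip1 D.
Proof. by rewrite /unzip1 /par_ctx -map_comp. Qed.

Lemma typing_distinct G D t A : typing G D t A -> distinct_vars G D.
Proof.
rewrite /distinct_vars; elim=> {G D t A} //.
- move=> G G' D D' t A pG pD _.
  by rewrite (perm_uniq (perm_map _ (perm_cat pG pD))).
- move=> G D x A B t _.
  rewrite -rcons_cat /unzip1 map_rcons rcons_uniq; by case/andP.
- move=> G D x A B t _.
  by rewrite cat_rcons /unzip1 !map_cat /= (uniq_catCA _ [:: x]) /= => /andP[].
- by move=> G D t A _; rewrite /= /unzip1 !map_cat -!/(unzip1 _) unzip1_par_ctx.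
Qed.

(** Through this lemma the closedness of the programs below follows from their typing, without
    inspecting the terms. *)
Lemma typing_scoped G D t A :
  typing G D t A -> scoped (fun n => n \in unzip1 (G ++ D)) t.
Proof.
elim=> {G D t A} //.
- move=> G G' D D' t A pG pD _; apply: scoped_sub => n.
  by rewrite (perm_mem (perm_map _ (perm_cat pG pD))).
- by move=> x A; rewrite /= inE.
- move=> G D x A B t _ H; apply: scoped_ren H => n.
  rewrite -rcons_cat /unzip1 map_rcons mem_rcons inE /bind_ren.
  by case: eqP.
- move=> G1 G2 D1 D2 t u A B _ _ H1 _ H2 /=; apply/andP; split.
    by apply: scoped_sub H1 => n; rewrite /unzip1 !map_cat !mem_cat => /orP[]->; rewrite ?orbT.
  by apply: scoped_sub H2 => n; rewrite /unzip1 !map_cat !mem_cat => /orP[]->; rewrite ?orbT.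
- move=> G D x A B t _ H; apply: scoped_ren H => n.
  rewrite /unzip1 !map_cat map_rcons !mem_cat mem_rcons inE /bind_ren.
  by case: eqP => //=; rewrite -mem_cat -map_cat.
- move=> G D z C t u A B _ _ H1 _ H2 /=; apply/andP; split.
    apply: scoped_sub H1 => n.
    by rewrite /unzip1 !map_cat map_rcons !mem_cat mem_rcons inE => /orP[]->; rewrite ?orbT.
  apply: scoped_sub H2 => n.
  by rewrite /unzip1 !map_cat map_rcons !mem_cat mem_rcons !inE /= => ->.
- move=> G D t u A B _ H1 _ H2 /=; rewrite H1.
  exact: scoped_sub H2.
- move=> G1 G2 D1 D2 t A _ _ H; apply: scoped_sub H => n.
  by rewrite /unzip1 !map_cat !mem_cat => /orP[]->; rewrite ?orbT.
- move=> G D x x1 x2 A B t _ _ H; apply: scoped_ren H => n.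
  by rewrite !inE /=; case: (n == x1); case: (n == x2); rewrite ?eqxx //= => ->; rewrite orbT.
- move=> G D t A _; apply: scoped_sub => n.
  by rewrite /= /unzip1 !map_cat -!/(unzip1 _) unzip1_par_ctx.
- move=> G1 G2 D1 D2 x t u A B _ _ H1 _ H2; apply: scoped_subst H2 => n.
  case: eqP => [_ _|nx].
    by apply: scoped_sub H1 => k; rewrite /unzip1 !map_cat !mem_cat => /orP[]->; rewrite ?orbT.
  rewrite /= /unzip1 !map_cat /= !mem_cat inE; move/eqP/negbTE: nx => ->.
  by case/orP=> /= ->; rewrite ?orbT.
- by move=> G D k t u v A _ /= -> _ -> _ ->.
Qed.

Lemma typing_closed t A : typing [::] [::] t A -> closed t.
Proof. by move/typing_scoped; apply: scoped_sub. Qed.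

(** A boolean condition, so that for concrete contexts it is settled by computation. *)
Definition sub_ctx (G1 D1 G D : context) : bool :=
  [&& distinct_vars G D, all (mem G) G1 & all (mem D) D1].

Lemma perm_sub_cat (T : eqType) (s r : seq T) :
  uniq s -> uniq r -> all (mem r) s ->
  perm_eq (s ++ [seq x <- r | x \notin s]) r.
Proof.
move=> us ur /allP sr; apply: uniq_perm => //.
  rewrite cat_uniq us filter_uniq // andbT /=.
  by apply/hasPn => x; rewrite mem_filter => /andP[].
move=> x; rewrite mem_cat mem_filter.
by case xs: (x \in s) => //=; apply/esym/sr.
Qed.

(** Weakening by the missing declarations, followed by an exchange: contexts without repetition
    behave as finite sets. *)
Lemma ty_sub G1 D1 G D t A :
  typing G1 D1 t A -> sub_ctx G1 D1 G D -> typing G D t A.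
Proof.
move=> ht /and3P[dGD sG sD].
have split_uniq (X Y : context) : distinct_vars X Y -> uniq X /\ uniq Y.
  by move/map_uniq; rewrite cat_uniq => /and3P[].
have [uG uD] := split_uniq _ _ dGD.
have [uG1 uD1] := split_uniq _ _ (typing_distinct ht).
have pG := perm_sub_cat uG1 uG sG; have pD := perm_sub_cat uD1 uD sD.
apply: (ty_exch pG pD); apply: ty_weak => //.
by rewrite /distinct_vars (perm_uniq (perm_map _ (perm_cat pG pD))).
Qed.

Lemma ty_var G D x A : sub_ctx [::] [:: (x, A)] G D -> typing G D (Var x) A.
Proof. exact/ty_sub/ty_id. Qed.

Lemma ty_app G1 D1 G2 D2 A G D t u B :
  typing G1 D1 t (Lolli A B) -> typing G2 D2 u A ->
  distinct_vars (G1 ++ G2) (D1 ++ D2) ->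
  sub_ctx (G1 ++ G2) (D1 ++ D2) G D ->
  typing G D (App t u) B.
Proof. by move=> ht hu d; apply: ty_sub (ty_lolli_e d ht hu). Qed.

Lemma ty_app_closed A G D t u B :
  typing [::] [::] t (Lolli A B) -> typing G D u A -> typing G D (App t u) B.
Proof.
by move=> ht hu; apply: (ty_lolli_e (G1 := [::]) (D1 := [::])) (typing_distinct hu) ht hu.
Qed.

Lemma ty_closed G D t A :
  typing [::] [::] t A -> distinct_vars G D -> typing G D t A.
Proof. by move=> ht d; apply: (ty_sub ht); rewrite /sub_ctx d. Qed.

Lemma ty_app_to_closed A G D t u B :
  typing G D t (Lolli A B) -> typing [::] [::] u A -> typing G D (App t u) B.
Proof.
move=> ht hu; have d := typing_distinct ht.
rewrite -(cats0 G) -(cats0 D).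
by apply: ty_lolli_e ht hu; rewrite !cats0.
Qed.

Lemma ty_arrow_app z C A G1 G D t u B :
  typing G1 D t (Arrow A B) -> typing [::] [:: (z, C)] u A ->
  distinct_vars (rcons G1 (z, C)) D ->
  sub_ctx (rcons G1 (z, C)) D G D ->
  typing G D (App t u) B.
Proof. by move=> ht hu d; apply: ty_sub (ty_arrow_e d ht hu). Qed.

(** The contracted term is given through an equation, since unification cannot recover the term
    before the merge; [ty_par_let] has the same form for the same reason. *)
Lemma ty_contract x1 x2 t x A G D t' B :
  typing ((x1, A) :: (x2, A) :: G) D t B ->
  t' = merge_var x x1 x2 t -> distinct_vars ((x, A) :: G) D ->
  typing ((x, A) :: G) D t' B.
Proof. by move=> ht -> d; apply: ty_cntr d ht. Qed.

Lemma ty_par_let x u t A G1 D1 G2 D2 G D t' B :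
  typing G1 D1 u (Par A) -> typing G2 ((x, Par A) :: D2) t B ->
  t' = subst_var u x t ->
  distinct_vars (G1 ++ G2) (D1 ++ D2) ->
  sub_ctx (G1 ++ G2) (D1 ++ D2) G D ->
  typing G D t' B.
Proof. by move=> hu ht -> d; apply: ty_sub (ty_par_e d hu ht). Qed.

Lemma typing_par_iter k D t A :
  typing [::] D t A -> typing [::] (iter k par_ctx D) t (parn k A).
Proof. by move=> ht; elim: k => //= k IH; apply: (@ty_par_i [::]). Qed.

Lemma iter_par_ctx1 k x A : iter k par_ctx [:: (x, A)] = [:: (x, parn k A)].
Proof. by elim: k => //= k ->. Qed.

Lemma iter_par_ctx2 k x A y B :
  iter k par_ctx [:: (x, A); (y, B)] = [:: (x, parn k A); (y, parn k B)].
Proof. by elim: k => //= k ->. Qed.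

(** Functoriality of $\S^k$: [F] applied to a variable is boxed [k] times, then §-elimination
    substitutes [u] for that variable. *)
Lemma ty_par_map k G D F u A B :
  typing [::] [::] F (Lolli A B) -> typing G D u (parn k A) ->
  typing G D (App F u) (parn k B).
Proof.
(* For [k = 0] the type of [u] need not start with §, so §-elimination is replaced by plain
   application. *)
move=> hF; case: k => [|k] hu; first exact: ty_app_closed hF hu.
have hy : typing [::] [:: (0, A)] (App F (Var 0)) B.
  by apply: ty_app_closed hF _; apply: ty_id.
have := typing_par_iter k.+1 hy; rewrite iter_par_ctx1 => {}hy.
have := ty_par_e (D2 := [::]) _ hu hy; rewrite !cats0 => /(_ (typing_distinct hu)).
by rewrite svE sv_closed ?(typing_closed hF).
Qed.

(** The binary analogue: the boxed application to two variables receives [v] and then [u] by two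
    successive §-eliminations. *)
Lemma ty_par_map2 k x y T U F u v A B C : x != y ->
  typing [::] [::] F (Lolli A (Lolli B C)) ->
  typing [::] [:: (x, T)] u (parn k A) ->
  typing [::] [:: (y, U)] v (parn k B) ->
  typing [::] [:: (x, T); (y, U)] (App (App F u) v) (parn k C).
Proof.
move=> xy hF hu hv.
have dxy V V' : distinct_vars [::] [:: (x, V); (y, V')].
  by rewrite /distinct_vars /= inE xy.
case: k hu hv => [|k] hu hv.
  apply: (ty_lolli_e (G1 := [::]) (D1 := [:: (x, T)])) (dxy _ _) _ hv.
  exact: ty_app_closed hF hu.
have hxy : typing [::] [:: (x, A); (y, B)] (App (App F (Var x)) (Var y)) C.
  apply: (ty_lolli_e (G1 := [::]) (D1 := [:: (x, A)])) (dxy _ _) _ (ty_id _ _).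
  by apply: ty_app_closed hF _; apply: ty_id.
have := typing_par_iter k.+1 hxy; rewrite iter_par_ctx2 => {}hxy.
have cF := typing_closed hF.
have yx : (x == y) = false by apply: negbTE.
have h1 : typing [::] [:: (x, parn k.+1 A); (y, U)] (App (App F (Var x)) v)
            (parn k.+1 C).
  apply: (@ty_exch [::] _ [:: (y, U); (x, parn k.+1 A)]) => //.
    by rewrite (perm_catC [:: _] [:: _]).
  have -> : App (App F (Var x)) v = subst_var v y (App (App F (Var x)) (Var y)).
    by rewrite !svE yx eqxx sv_closed.
  apply: (ty_par_e (G1 := [::]) (D1 := [:: _])) hv _.
    by rewrite /distinct_vars /= inE eq_sym yx.
  by apply: (ty_exch (perm_refl _) _ hxy); rewrite (perm_catC [:: _] [:: _]).
have -> : App (App F u) v = subst_var u x (App (App F (Var x)) v).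
  (* The only variable that may occur in [v] is [y], so substituting for [x] leaves [v]
     unchanged. *)
  rewrite !svE eqxx sv_closed //; congr App; symmetry.
  apply: subst_id_on (typing_scoped hv) => n.
  by rewrite /= inE => /eqP ->; rewrite eq_sym yx.
exact: (ty_par_e (G1 := [::]) (D1 := [:: _]) (dxy _ _) hu h1).
Qed.

(** * Church numerals and words *)

(** Church numerals, that is, the type [W] over a one-letter alphabet. *)
Definition Nat : type :=
  Forall (Arrow (Lolli (TVar 0) (TVar 0)) (Par (Lolli (TVar 0) (TVar 0)))).

Lemma ty_Nat_i G D t :
  not_free_in 0 G D ->
  typing G D t
    (Arrow (Lolli (TVar 0) (TVar 0)) (Par (Lolli (TVar 0) (TVar 0)))) ->
  typing G D t Nat.
Proof. exact: ty_forall_i. Qed.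

Lemma ty_Nat_e A G D t :
  typing G D t Nat ->
  typing G D t (Arrow (Lolli A A) (Par (Lolli A A))).
Proof. exact: ty_forall_e. Qed.

Lemma ty_W_i G D t :
  not_free_in 0 G D ->
  typing G D t (Arrow (Lolli (TVar 0) (TVar 0)) (Arrow (Lolli (TVar 0) (TVar 0))
    (Par (Lolli (TVar 0) (TVar 0))))) ->
  typing G D t W.
Proof. exact: ty_forall_i. Qed.

Lemma ty_W_e A G D t :
  typing G D t W ->
  typing G D t (Arrow (Lolli A A) (Arrow (Lolli A A) (Par (Lolli A A)))).
Proof. exact: ty_forall_e. Qed.

Definition zero : term := abs 0 (abs 1 (Var 1)).

Definition succ : term :=
  abs 0 (abs 1 (abs 2 (App (Var 1) (App (App (Var 0) (Var 1)) (Var 2))))).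

Definition add : term :=
  abs 0 (abs 1 (abs 2 (abs 3 (App (App (Var 0) (Var 2))
                                  (App (App (Var 1) (Var 2)) (Var 3)))))).

(* Iterates [(u, v) |-> (f u, u)] on additive pairs, which are the functions
   from booleans: linear resources are shared by the branches of [If]. *)
Definition decr : term :=
  abs 0 (abs 1 (abs 2 (App (App (App (Var 0)
    (abs 3 (abs 4 (If (Var 4) (App (Var 1) (App (Var 3) tmT))
                              (App (Var 3) tmT)))))
    (abs 4 (Var 2))) tmF))).

Definition isz : term := abs 0 (App (App (Var 0) (abs 1 tmF)) tmT).

Definition mul : term :=
  abs 0 (abs 1 (App (App (Var 1) (App add (Var 0))) zero)).

(* Iterated on its numeral, this turns a single linear occurrence of it into
   one non-linear and one linear argument of a continuation. *)
Definition dup_succ : term :=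
  abs 0 (abs 1 (App (Var 0)
    (abs 2 (abs 3 (App (App (Var 1) (App succ (Var 2))) (App succ (Var 3))))))).

Definition dup_zero : term := abs 0 (App (App (Var 0) zero) zero).

Definition square : term :=
  abs 0 (App (App (App (Var 0) dup_succ) dup_zero) mul).

Definition wnil : term := abs 0 (abs 1 (abs 2 (Var 2))).

Definition wcons (b : bool) : term :=
  abs 0 (abs 1 (abs 2 (abs 3
    (App (Var (if b then 2 else 1))
         (App (App (App (Var 0) (Var 1)) (Var 2)) (Var 3)))))).

(** Extensionally the identity on words: rebuilding a word from its constructors moves it under one
    §. *)
Definition lift_word : term :=
  abs 0 (App (App (App (Var 0) (wcons false)) (wcons true)) wnil).

Definition len : term := abs 0 (abs 1 (App (App (Var 0) (Var 1)) (Var 1))).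

(** * Typing of the operations on numerals and words *)

Local Notation E := (Lolli (TVar 0) (TVar 0)).

Lemma ty_zero : typing [::] [::] zero Nat.
Proof.
apply: ty_Nat_i => //; apply: ty_arrow_i => /=.
apply: (@ty_par_i [:: (0, E)] [::]); apply: ty_lolli_i => /=.
exact: ty_var.
Qed.

(** A pattern that recurs below: contraction splits [f] into copies 5 and 6, §-elimination gives the
    name 7 to the iterate built from copy 6, and §-introduction strips the § of 7 while turning copy
    5 into a linear variable. *)
Lemma ty_succ : typing [::] [::] succ (Lolli Nat Nat).
Proof.
apply: ty_lolli_i => /=; apply: ty_Nat_i => //; apply: ty_arrow_i => /=.
apply: (@ty_contract 5 6
  (abs 2 (App (Var 5) (App (App (Var 0) (Var 6)) (Var 2))))) => //.
apply: (@ty_par_let 7 (App (Var 0) (Var 6))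
  (abs 2 (App (Var 5) (App (Var 7) (Var 2)))) E
  [:: (6, E)] [:: (0, Nat)] [:: (5, E)] [::]) => //.
  apply: (@ty_arrow_app 6 E E [::]) => //; last exact: ty_id.
  exact/ty_Nat_e/ty_id.
apply: (@ty_par_i [:: (5, E)] [:: (7, E)]); apply: ty_lolli_i => /=.
apply: (@ty_app [::] [:: (5, E)] [::] [:: (7, E); (2, TVar 0)] (TVar 0)) => //.
  exact: ty_id.
apply: (@ty_app [::] [:: (7, E)] [::] [:: (2, TVar 0)] (TVar 0)) => //;
  exact: ty_id.
Qed.

Lemma ty_add : typing [::] [::] add (Lolli Nat (Lolli Nat Nat)).
Proof.
apply: ty_lolli_i; apply: ty_lolli_i => /=.
apply: ty_Nat_i => //; apply: ty_arrow_i => /=.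
apply: (@ty_contract 5 6
  (abs 3 (App (App (Var 0) (Var 5)) (App (App (Var 1) (Var 6)) (Var 3))))) => //.
apply: (@ty_par_let 7 (App (Var 0) (Var 5))
  (abs 3 (App (Var 7) (App (App (Var 1) (Var 6)) (Var 3)))) E
  [:: (5, E)] [:: (0, Nat)] [:: (6, E)] [:: (1, Nat)]) => //.
  apply: (@ty_arrow_app 5 E E [::]) => //; last exact: ty_id.
  exact/ty_Nat_e/ty_id.
apply: (@ty_par_let 8 (App (Var 1) (Var 6))
  (abs 3 (App (Var 7) (App (Var 8) (Var 3)))) E
  [:: (6, E)] [:: (1, Nat)] [::] [:: (7, Par E)]) => //.
  apply: (@ty_arrow_app 6 E E [::]) => //; last exact: ty_id.
  exact/ty_Nat_e/ty_id.
apply: (@ty_par_i [::] [:: (8, E); (7, E)]); apply: ty_lolli_i => /=.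
apply: (@ty_app [::] [:: (7, E)] [::] [:: (8, E); (3, TVar 0)] (TVar 0)) => //.
  exact: ty_id.
apply: (@ty_app [::] [:: (8, E)] [::] [:: (3, TVar 0)] (TVar 0)) => //;
  exact: ty_id.
Qed.

Lemma ty_decr : typing [::] [::] decr (Lolli Nat Nat).
Proof.
(* [P] is the type of additive pairs over $\alpha$: [tmT] selects the first component and [tmF] the
   second. *)
pose P := Lolli Boolean (TVar 0).
set f' := abs 3 (abs 4 (If (Var 4) (App (Var 1) (App (Var 3) tmT))
                              (App (Var 3) tmT))).
apply: ty_lolli_i => /=; apply: ty_Nat_i => //; apply: ty_arrow_i => /=.
apply: (@ty_par_let 7 (App (Var 0) f')
  (abs 2 (App (App (Var 7) (abs 4 (Var 2))) tmF)) (Lolli P P)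
  [:: (1, E)] [:: (0, Nat)] [::] [::]) => //.
  apply: (@ty_arrow_app 1 E (Lolli P P) [::]) => //.
    exact/ty_Nat_e/ty_id.
  apply: ty_lolli_i; apply: ty_lolli_i => /=; apply: (@ty_Be _ _ 0).
  - exact: ty_var.
  - apply: (@ty_app [::] [:: (1, E)] [::] [:: (3, P)] (TVar 0)) => //.
      exact: ty_id.
    by apply: (@ty_app_to_closed Boolean); [apply: ty_id|apply: ty_B1i].
  - by apply: (@ty_app_to_closed Boolean); [apply: ty_var|apply: ty_B1i].
apply: (@ty_par_i [::] [:: (7, Lolli P P)]); apply: ty_lolli_i => /=.
apply: (@ty_app_to_closed Boolean); last exact: ty_B0i.
apply: (@ty_app [::] [:: (7, Lolli P P)] [::] [:: (2, TVar 0)] P) => //.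
  exact: ty_id.
by apply: ty_lolli_i; apply: ty_var.
Qed.

(** The § on the result is harmless in tests, since the guard of an [If] may have any type
    $\S^k\mathbf{Bool}$. *)
Lemma ty_isz : typing [::] [::] isz (Lolli Nat (Par Boolean)).
Proof.
apply: ty_lolli_i => /=.
apply: (@ty_par_let 7 (App (Var 0) (abs 1 tmF)) (App (Var 7) tmT)
  (Lolli Boolean Boolean) [::] [:: (0, Nat)] [::] [::]) => //.
  apply: ty_arrow_e0; first exact/ty_Nat_e/ty_id.
  by apply: ty_lolli_i; apply: ty_closed => //; apply: ty_B0i.
apply: (@ty_par_i [::] [:: (7, Lolli Boolean Boolean)]).
by apply: (@ty_app_to_closed Boolean); [apply: ty_id|apply: ty_B1i].
Qed.

(** The first factor is non-linear because it occurs in the iterated function, which is the argument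
    of an $\Rightarrow$. *)
Lemma ty_mul : typing [::] [::] mul (Arrow Nat (Lolli Nat (Par Nat))).
Proof.
apply: ty_arrow_i; apply: ty_lolli_i => /=.
apply: (@ty_par_let 7 (App (Var 1) (App add (Var 0))) (App (Var 7) zero)
  (Lolli Nat Nat) [:: (0, Nat)] [:: (1, Nat)] [::] [::]) => //.
  apply: (@ty_arrow_app 0 Nat (Lolli Nat Nat) [::]) => //.
    exact/ty_Nat_e/ty_id.
  by apply: ty_app_closed ty_add _; apply: ty_id.
apply: (@ty_par_i [::] [:: (7, Lolli Nat Nat)]).
by apply: ty_app_to_closed ty_zero; apply: ty_id.
Qed.

(** The outer § is due to the iteration of [dup_succ], the inner one to the multiplication that the
    continuation performs. [K] is the type of continuations and [B] that of the iterated object. *)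
Lemma ty_square : typing [::] [::] square (Lolli Nat (Par (Par Nat))).
Proof.
pose K := Arrow Nat (Lolli Nat (Par Nat)).
pose B := Lolli K (Par Nat).
apply: ty_lolli_i => /=.
apply: (@ty_par_let 7 (App (Var 0) dup_succ) (App (App (Var 7) dup_zero) mul)
  (Lolli B B) [::] [:: (0, Nat)] [::] [::]) => //.
  apply: ty_arrow_e0; first exact/ty_Nat_e/ty_id.
  apply: ty_lolli_i; apply: ty_lolli_i => /=.
  apply: (@ty_app [::] [:: (0, B)] [::] [:: (1, K)] K) => //; first exact: ty_id.
  apply: ty_arrow_i; apply: ty_lolli_i => /=.
  apply: (@ty_app [:: (2, Nat)] [:: (1, K)] [::] [:: (3, Nat)] Nat) => //.
    apply: (@ty_arrow_app 2 Nat Nat [::]) => //; first exact: ty_id.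
    by apply: ty_app_closed ty_succ _; apply: ty_id.
  by apply: ty_app_closed ty_succ _; apply: ty_id.
apply: (@ty_par_i [::] [:: (7, Lolli B B)]).
apply: ty_app_to_closed ty_mul.
apply: (@ty_app_to_closed B); first exact: ty_id.
apply: ty_lolli_i => /=; apply: ty_app_to_closed ty_zero.
by apply: ty_arrow_e0 ty_zero; apply: ty_id.
Qed.

Lemma ty_wnil : typing [::] [::] wnil W.
Proof.
apply: ty_W_i => //; apply: ty_arrow_i; apply: ty_arrow_i => /=.
apply: (@ty_par_i [:: (0, E); (1, E)] [::]); apply: ty_lolli_i => /=.
exact: ty_var.
Qed.

Lemma ty_wcons b : typing [::] [::] (wcons b) (Lolli W W).
Proof.
apply: ty_lolli_i => /=; apply: ty_W_i => //.
apply: ty_arrow_i; apply: ty_arrow_i => /=.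
(* [x] is the variable used twice; its copies before contraction are 5 and 6. *)
pose i := if b then 1 else 6; pose j := if b then 6 else 2.
pose x := if b then 2 else 1; pose y := if b then 1 else 2.
apply: (@ty_exch [:: (x, E); (y, E)] _ [:: (0, W)]) => //;
  try by rewrite /i /j /x /y; case: (b).
apply: (@ty_contract 5 6 (abs 3 (App (Var 5)
  (App (App (App (Var 0) (Var i)) (Var j)) (Var 3)))));
  try by rewrite /i /j /x /y; case: (b).
apply: (@ty_par_let 7 (App (App (Var 0) (Var i)) (Var j))
  (abs 3 (App (Var 5) (App (Var 7) (Var 3)))) E
  [:: (i, E); (j, E)] [:: (0, W)] [:: (5, E)] [::]);
  try by rewrite /i /j /x /y; case: (b).
  apply: (@ty_arrow_app j E E [:: (i, E)]);
  try by rewrite /i /j /x /y; case: (b).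
    apply: (@ty_arrow_app i E E [::]);
  try by rewrite /i /j /x /y; case: (b).
      exact/ty_W_e/ty_id.
    exact: ty_id.
  exact: ty_id.
apply: (@ty_par_i [:: (5, E)] [:: (7, E)]); apply: ty_lolli_i => /=.
apply: (@ty_app [::] [:: (5, E)] [::] [:: (7, E); (3, TVar 0)] (TVar 0)) => //.
  exact: ty_id.
apply: (@ty_app [::] [:: (7, E)] [::] [:: (3, TVar 0)] (TVar 0)) => //;
  exact: ty_id.
Qed.

Lemma ty_lift_word : typing [::] [::] lift_word (Lolli W (Par W)).
Proof.
apply: ty_lolli_i => /=.
apply: (@ty_par_let 7 (App (App (Var 0) (wcons false)) (wcons true))
  (App (Var 7) wnil) (Lolli W W) [::] [:: (0, W)] [::] [::]) => //.
  apply: ty_arrow_e0 (ty_wcons _); apply: ty_arrow_e0 (ty_wcons _).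
  exact/ty_W_e/ty_id.
apply: (@ty_par_i [::] [:: (7, Lolli W W)]).
by apply: ty_app_to_closed ty_wnil; apply: ty_id.
Qed.

(** Giving both letters the same function turns the instance of [W] directly into that of [Nat], so
    no additional § appears. *)
Lemma ty_len : typing [::] [::] len (Lolli W Nat).
Proof.
apply: ty_lolli_i => /=; apply: ty_Nat_i => //; apply: ty_arrow_i => /=.
apply: (@ty_contract 5 6 (App (App (Var 0) (Var 5)) (Var 6))) => //.
apply: (@ty_arrow_app 6 E E [:: (5, E)]) => //; last exact: ty_id.
apply: (@ty_arrow_app 5 E E [::]) => //; last exact: ty_id.
exact/ty_W_e/ty_id.
Qed.

(** * Reduction *)

Local Notation reds := (clos_refl_trans term red).

Lemma reds_refl t : reds t t.
Proof. exact: rt_refl. Qed.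

Lemma reds_trans u t v : reds t u -> reds u v -> reds t v.
Proof. exact: rt_trans. Qed.

Lemma reds_map (F : term -> term) t u :
  (forall t u, red t u -> red (F t) (F u)) -> reds t u -> reds (F t) (F u).
Proof.
move=> hF; elim=> [a b|a|a b c _ h1 _ h2].
- by move=> r; apply/rt_step/hF.
- exact: reds_refl.
- exact: reds_trans h1 h2.
Qed.

Lemma reds_Lam t t' : reds t t' -> reds (Lam t) (Lam t').
Proof. by apply: (reds_map (F := Lam)) => *; apply: red_Lam. Qed.

Lemma reds_App t t' u u' : reds t t' -> reds u u' -> reds (App t u) (App t' u').
Proof.
move=> ht hu; apply: (@reds_trans (App t' u)).
  by apply: (reds_map (F := App^~ u)) ht => *; apply: red_App1.
by apply: (reds_map (F := App t')) hu => *; apply: red_App2.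
Qed.

Lemma reds_App1 u t t' : reds t t' -> reds (App t u) (App t' u).
Proof. by move=> ht; apply: reds_App ht (reds_refl _). Qed.

Lemma reds_App2 t u u' : reds u u' -> reds (App t u) (App t u').
Proof. exact: reds_App (reds_refl _). Qed.

Definition tmbool (b : bool) : term := if b then tmT else tmF.

Lemma reds_If (b : bool) t u v w :
  reds t (tmbool b) -> reds (if b then u else v) w -> reds (If t u v) w.
Proof.
move=> ht hw; apply: reds_trans hw; apply: (@reds_trans (If (tmbool b) u v)).
  by apply: (reds_map (F := fun t => If t u v)) ht => *; apply: red_If1.
by case: b {ht}; apply/rt_step/red_redex; constructor.
Qed.

Lemma reds_beta t u v : reds (inst t u) v -> reds (App (Lam t) u) v.
Proof. by apply: reds_trans; apply/rt_step/red_redex/redex_beta. Qed.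

(** Contracting a named abstraction is named substitution; with [svE] this lets reductions be
    computed on the programs as written. *)
Lemma inst_abs x t u : inst (ren (bind_ren x) t) u = subst_var u x t.
Proof.
rewrite /inst subst_ren; apply: subst_ext => n /=.
by rewrite /bind_ren; case: eqP.
Qed.

Lemma reds_abs x t u v : reds (subst_var u x t) v -> reds (App (abs x t) u) v.
Proof. by rewrite -inst_abs; apply: reds_beta. Qed.

Lemma inst_renS t u : inst (ren S t) u = t.
Proof. by rewrite /inst subst_ren -[RHS]subst_Var; apply: subst_ext. Qed.

Definition num (n : nat) : term := Lam (Lam (iter n (App (Var 1)) (Var 0))).

Lemma ren_iter r n a b :
  ren r (iter n (App a) b) = iter n (App (ren r a)) (ren r b).
Proof. by elim: n => //= n ->. Qed.

Lemma subst_iter s n a b :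
  subst s (iter n (App a) b) = iter n (App (subst s a)) (subst s b).
Proof. by elim: n => //= n ->. Qed.

Lemma closed_num n : closed (num n).
Proof. by rewrite /closed /num /=; elim: n => //= n ->. Qed.

Lemma reds_num n f x v :
  reds (iter n (App f) x) v -> reds (App (App (num n) f) x) v.
Proof.
apply: reds_trans.
apply: (@reds_trans (App (Lam (iter n (App (ren S f)) (Var 0))) x)).
  apply: reds_App1; apply: reds_beta.
  by rewrite /inst /= subst_iter; apply: reds_refl.
apply: reds_beta.
by rewrite /inst subst_iter -/(inst _ _) inst_renS; apply: reds_refl.
Qed.

Lemma closed_iter n a b : closed a -> closed b -> closed (iter n (App a) b).
Proof. by move=> ca cb; rewrite /closed; elim: n => //= n ->; rewrite andbT. Qed.

Lemma closed_zero : closed zero. Proof. exact: typing_closed ty_zero. Qed.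
Lemma closed_succ : closed succ. Proof. exact: typing_closed ty_succ. Qed.
Lemma closed_add : closed add. Proof. exact: typing_closed ty_add. Qed.
Lemma closed_decr : closed decr. Proof. exact: typing_closed ty_decr. Qed.
Lemma closed_isz : closed isz. Proof. exact: typing_closed ty_isz. Qed.
Lemma closed_mul : closed mul. Proof. exact: typing_closed ty_mul. Qed.
Lemma closed_wcons b : closed (wcons b).
Proof. exact: typing_closed (ty_wcons b). Qed.
Lemma closed_wnil : closed wnil. Proof. exact: typing_closed ty_wnil. Qed.

Definition sv_constE := (fun u x => @sv_closed u x _ closed_zero,
  fun u x => @sv_closed u x _ closed_succ, fun u x => @sv_closed u x _ closed_add,
  fun u x => @sv_closed u x _ closed_decr, fun u x => @sv_closed u x _ closed_isz,
  fun u x => @sv_closed u x _ closed_mul,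
  fun u x b => @sv_closed u x _ (closed_wcons b),
  fun u x => @sv_closed u x _ closed_wnil,
  fun u x n => @sv_closed u x _ (closed_num n)).

Lemma reds_succ t n : reds t (num n) -> reds (App succ t) (num n.+1).
Proof.
move=> /(reds_App2 succ)/reds_trans; apply; apply: reds_abs.
have key f x := reds_num (reds_refl (iter n (App f) x)).
(* The numeral is generalised to a closed term, of which only its iterating behaviour is kept, so
   that simplification does not unfold it. *)
move: (num n) (closed_num n) key => m cm key.
rewrite !(sv_abs, svE) //= /abs /= !ren_closed //.
by do 2!apply: reds_Lam; apply: reds_App2.
Qed.

Lemma reds_add t n u m :
  reds t (num n) -> reds u (num m) -> reds (App (App add t) u) (num (n + m)).
Proof.
move=> ht hu; apply: reds_trans (reds_App (reds_App2 add ht) hu) _.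
have keyn f x := reds_num (reds_refl (iter n (App f) x)).
have keym f x := reds_num (reds_refl (iter m (App f) x)).
move: (num n) (closed_num n) keyn (num m) (closed_num m) keym.
move=> a ca keya b cb keyb.
apply: (@reds_trans (App (subst_var a 0 (abs 1 (abs 2 (abs 3
    (App (App (Var 0) (Var 2)) (App (App (Var 1) (Var 2)) (Var 3))))))) b)).
  exact/reds_App1/reds_abs/reds_refl.
rewrite !(sv_abs, svE) //=; apply: reds_abs.
rewrite !(sv_abs, svE) //= sv_closed // /abs /= !ren_closed //.
do 2!apply: reds_Lam; apply: reds_trans (keya _ _) _; rewrite iterD.
by elim: (n) => [|k IH] //=; apply: reds_App2.
Qed.

Lemma reds_decr t n : reds t (num n) -> reds (App decr t) (num n.-1).
Proof.
move=> /(reds_App2 decr)/reds_trans; apply; apply: reds_abs.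
have key f x := reds_num (reds_refl (iter n (App f) x)).
move: (num n) (closed_num n) key => m cm key.
rewrite !(sv_abs, svE) //= /abs /= !ren_closed //.
do 2!apply: reds_Lam; set f := Lam _.
apply: (@reds_trans (App (iter n (App f) (Lam (Var 1))) tmF)).
  exact: reds_App1.
have step b g : reds (App (App f g) (tmbool b))
    (if b then App (Var 1) (App g tmT) else App g tmT).
  apply: (@reds_trans (App (Lam (If (Var 0) (App (Var 2) (App (ren S g) tmT))
                                  (App (ren S g) tmT))) (tmbool b))).
    exact/reds_App1/reds_beta/reds_refl.
  apply: reds_beta; rewrite /inst /= -/(inst _ _) inst_renS.
  by apply: (@reds_If b); first exact: reds_refl; case: b; apply: reds_refl.
(* The first component of the [k]-th pair is $f^k x$, where [Var 1] is $f$ and [Var 0] is $x$. *)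
have topT k : reds (App (iter k (App f) (Lam (Var 1))) tmT)
    (iter k (App (Var 1)) (Var 0)).
  elim: k => [|k IH] /=; first by apply/reds_beta/reds_refl.
  by apply: reds_trans (step true _) _; apply: reds_App2.
(* The result is a second component: that of the initial pair $(x, x)$ for zero, and otherwise the
   first component of the preceding pair. *)
case: n {key} => [|n] /=; first by apply/reds_beta/reds_refl.
exact: reds_trans (step false _) (topT n).
Qed.

Lemma reds_isz t n : reds t (num n) -> reds (App isz t) (tmbool (n == 0)).
Proof.
move=> /(reds_App2 isz)/reds_trans; apply; apply: reds_abs.
rewrite !(sv_abs, svE) ?closed_num //=; apply: reds_num.
case: n => [|n] /=; first exact: reds_refl.
exact/reds_abs/reds_refl.
Qed.

Lemma reds_mul t n u m :
  reds t (num n) -> reds u (num m) -> reds (App (App mul t) u) (num (m * n)).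
Proof.
move=> ht hu; apply: reds_trans (reds_App (reds_App2 mul ht) hu) _.
have cn := closed_num n; have cm := closed_num m.
apply: (@reds_trans (App (subst_var (num n) 0
    (abs 1 (App (App (Var 1) (App add (Var 0))) zero))) (num m))).
  by apply/reds_App1/reds_abs/reds_refl.
rewrite !(sv_constE, sv_abs, svE) //= ?sv_closed //; apply: reds_abs.
rewrite !(sv_constE, svE) /= ?sv_closed //; apply: reds_num.
elim: m {hu cm} => [|m IH] /=; first exact: reds_refl.
by rewrite mulSn; apply: reds_add IH; apply: reds_refl.
Qed.

(** An unevaluated numeral: its typing is immediate, and it is the form in which [dup_succ] builds
    its copies. *)
Definition cnum (n : nat) : term := iter n (App succ) zero.

Lemma ty_cnum n : typing [::] [::] (cnum n) Nat.
Proof.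
elim: n => [|n IH]; first exact: ty_zero.
exact: ty_app_closed ty_succ IH.
Qed.

Lemma closed_cnum n : closed (cnum n).
Proof. exact: typing_closed (ty_cnum n). Qed.

Lemma reds_cnum n : reds (cnum n) (num n).
Proof. by elim: n => [|n IH]; [apply: reds_refl|apply: reds_succ]. Qed.

(** Induction over all closed continuations: one [dup_succ] replaces [k] by the closed term $\lambda
    x.\lambda y.\,k\,(\mathrm{succ}\,x)(\mathrm{succ}\,y)$, to which the hypothesis for [n]
    applies. *)
Lemma reds_dup n k v : closed k ->
  reds (App (App k (cnum n)) (cnum n)) v ->
  reds (App (iter n (App dup_succ) dup_zero) k) v.
Proof.
elim: n k => [|n IH] k ck hv /=.
  by apply: reds_abs; rewrite !(sv_constE, svE) /= ?sv_closed.
set J := iter _ _ _ in IH *.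
have cJ : closed J by apply: closed_iter.
apply: (@reds_trans (App J (abs 2 (abs 3
    (App (App k (App succ (Var 2))) (App succ (Var 3))))))).
  apply: (@reds_trans (App (subst_var J 0 (abs 1 (App (Var 0) (abs 2 (abs 3
      (App (App (Var 1) (App succ (Var 2))) (App succ (Var 3)))))))) k)).
    exact/reds_App1/reds_abs/reds_refl.
  rewrite !(sv_constE, sv_abs, svE) //= ?sv_closed //; apply: reds_abs.
  by rewrite !(sv_constE, sv_abs, svE) //= ?sv_closed //; apply: reds_refl.
apply: IH.
  rewrite /closed /abs /=.
  by rewrite !ren_closed // ?closed_scoped //=.
have cn := closed_cnum n.
apply: (@reds_trans (App (subst_var (cnum n) 2 (abs 3
    (App (App k (App succ (Var 2))) (App succ (Var 3))))) (cnum n))).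
  exact/reds_App1/reds_abs/reds_refl.
rewrite !(sv_constE, sv_abs, svE) //= ?sv_closed //; apply: reds_abs.
by rewrite !(sv_constE, sv_abs, svE) //= ?sv_closed.
Qed.

Lemma reds_square t n : reds t (num n) -> reds (App square t) (num (n ^ 2)).
Proof.
move=> /(reds_App2 square)/reds_trans; apply; apply: reds_abs.
rewrite !(sv_constE, svE) /= !sv_closed //.
apply: (@reds_trans (App (iter n (App dup_succ) dup_zero) mul)).
  exact/reds_App1/reds_num/reds_refl.
by apply: reds_dup => //; rewrite -mulnn; apply: reds_mul; apply: reds_cnum.
Qed.

Definition wfold (f0 f1 x : term) (w : seq bool) : term :=
  foldr (fun i => App (if i then f1 else f0)) x w.

Lemma subst_wfold s f0 f1 x w : subst s (wfold f0 f1 x w) =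
  wfold (subst s f0) (subst s f1) (subst s x) w.
Proof. by elim: w => //= -[] w ->. Qed.

Lemma wordE w : word w = Lam (Lam (Lam (wfold (Var 2) (Var 1) (Var 0) w))).
Proof. by rewrite /word; do 3!congr Lam; elim: w => //= -[] w ->. Qed.

Lemma closed_word w : closed (word w).
Proof. by rewrite /closed /word /=; elim: w => //= -[] w ->. Qed.

Lemma reds_word w f0 f1 x v :
  reds (wfold f0 f1 x w) v -> reds (App (App (App (word w) f0) f1) x) v.
Proof.
apply: reds_trans; rewrite wordE.
apply: (@reds_trans (App (App (Lam (Lam
    (wfold (ren S (ren S f0)) (Var 1) (Var 0) w))) f1) x)).
  do 2!apply: reds_App1; apply: reds_beta.
  by rewrite /inst /= subst_wfold; apply: reds_refl.
apply: (@reds_trans (App (Lam (wfold (ren S f0) (ren S f1) (Var 0) w)) x)).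
  apply: reds_App1; apply: reds_beta; rewrite /inst /= subst_wfold /=.
  suff -> : subst (up (fun n => if n is m.+1 then Var m else f1))
              (ren S (ren S f0)) = ren S f0 by apply: reds_refl.
  by rewrite !subst_ren ren_as_subst; apply: subst_ext.
apply: reds_beta; rewrite /inst subst_wfold -!/(inst _ _) !inst_renS.
exact: reds_refl.
Qed.

Lemma reds_wcons b t w :
  reds t (word w) -> reds (App (wcons b) t) (word (b :: w)).
Proof.
move=> /(reds_App2 (wcons b))/reds_trans; apply; apply: reds_abs.
have key f g x := reds_word (reds_refl (wfold f g x w)).
rewrite [word (b :: w)]wordE.
move: (word w) (closed_word w) key => m cm key.
by case: b; rewrite !(sv_abs, svE) //= /abs /= !ren_closed //;
  do 3!apply: reds_Lam; apply: reds_App2.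
Qed.

Lemma reds_lift_word t w : reds t (word w) -> reds (App lift_word t) (word w).
Proof.
move=> /(reds_App2 lift_word)/reds_trans; apply; apply: reds_abs.
rewrite !(sv_constE, svE) /= ?sv_closed //; apply: reds_word.
elim: w => [|b w IH] /=; first exact: reds_refl.
by case: b; apply: reds_wcons.
Qed.

Lemma reds_len t w : reds t (word w) -> reds (App len t) (num (size w)).
Proof.
move=> /(reds_App2 len)/reds_trans; apply; apply: reds_abs.
(* The word receives only two of its three arguments here, so [reds_word] does not apply. *)
have key : reds (App (App (word w) (Var 0)) (Var 0))
    (Lam (iter (size w) (App (Var 1)) (Var 0))).
  rewrite wordE.
  apply: (@reds_trans (App (Lam (Lam (wfold (Var 2) (Var 1) (Var 0) w))) (Var 0))).
    apply: reds_App1; apply: reds_beta.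
    by rewrite /inst /= subst_wfold; apply: reds_refl.
  apply: reds_beta; rewrite /inst /= subst_wfold /=.
  suff -> : wfold (Var 1) (Var 1) (Var 0) w = iter (size w) (App (Var 1)) (Var 0).
    exact: reds_refl.
  by elim: (w) => //= -[] s ->.
move: (word w) (closed_word w) key => m cm key.
rewrite !(sv_abs, svE) //= /abs /= !ren_closed //.
exact: reds_Lam.
Qed.

(** * Configurations and one step of the machine *)

(* [c T n] is the nth cell on the left of the head, and [c F n] the nth cell to
   the right, counting from the scanned one. *)
Definition Conf : type := Lolli Boolean (Lolli Nat Nat).

(** The numeral is the code of the state, which [Conf] does not contain. *)
Definition Acc : type := Lolli Nat (Lolli Conf Boolean).

Definition cell (c : term) (left : bool) (p : term) : term :=
  App (App c (tmbool left)) p.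

(** A query to the new tape becomes a query to the old one. After a left move, for instance, right
    cell 0 is the old left cell 0, right cell 1 is the written symbol [s], and the later right cells
    are shifted by one. Each branch queries [c] at most once. *)
Definition next_conf (c s : term) (m : move) : term :=
  abs 3 (abs 4 (match m with
  | MoveLeft => If (Var 3) (cell c true (App succ (Var 4)))
      (If (App isz (Var 4)) (cell c true (Var 4))
        (If (App isz (App decr (Var 4))) s (cell c false (App decr (Var 4)))))
  | MoveRight => If (Var 3)
      (If (App isz (Var 4)) s (cell c true (App decr (Var 4))))
      (cell c false (App succ (Var 4)))
  | Stay => If (Var 3) (cell c true (Var 4))
      (If (App isz (Var 4)) s (cell c false (Var 4)))
  end)).

(** The final [tmF] answers for numbers beyond the length of [l]; codes of states and symbols never
    reach it. *)
Fixpoint case_of (T : Type) (u : term) (l : seq T) (g : T -> term) : term :=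
  if l is x :: l' then If (App isz u) (g x) (case_of (App decr u) l' g) else tmF.

Definition code (T : finType) (x : T) : nat := index x (enum T).

(** [option bool] codes the three moves in a finite type, so that the successors can be
    enumerated. *)
Definition move_of (m : option bool) : move :=
  match m with
  | None => Stay
  | Some true => MoveLeft
  | Some false => MoveRight
  end.

Definition succs (N : atm) (q : state N) (s : symbol N) :
    seq (state N * symbol N * option bool) :=
  [seq x <- enum {: state N * symbol N * option bool}
     | delta q s x.1.1 x.1.2 (move_of x.2)].

Definition call (N : atm) (a c : term) (x : state N * symbol N * option bool) :
    term :=
  App (App a (cnum (code x.1.1)))
      (next_conf c (cnum (code x.1.2)) (move_of x.2)).

Definition any_of (T : Type) (f : T -> term) (l : seq T) : term :=
  foldr (fun x => If (f x) tmT) tmF l.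

Definition all_of (T : Type) (f : T -> term) (l : seq T) : term :=
  foldr (fun x t => If (f x) t tmF) tmT l.

Definition verdict (N : atm) (a c : term) (q : state N) (s : symbol N) : term :=
  match kind q with
  | Accepting => tmT
  | Rejecting => tmF
  | Existential => any_of (call a c) (succs q s)
  | Universal => all_of (call a c) (succs q s)
  end.

(** The arguments are parameters because they are variables in the typing and closed terms in the
    reduction. *)
Definition step_body (N : atm) (a q c : term) : term :=
  case_of q (enum (state N)) (fun q' =>
    case_of (cell c false zero) (enum (symbol N)) (verdict a c q')).

Definition step (N : atm) : term :=
  abs 0 (abs 1 (abs 2 (step_body N (Var 0) (Var 1) (Var 2)))).

(** The linear context serves [u] in every guard and [g] in every branch, as the context sharing of
    the [If] rule permits. *)
Lemma ty_case_of (T : Type) G D u (l : seq T) g :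
  typing G D u Nat -> (forall x, typing G D (g x) Boolean) ->
  typing G D (case_of u l g) Boolean.
Proof.
move=> hu hg; elim: l u hu => [|x l IH] u hu /=.
  exact: ty_closed ty_B0i (typing_distinct hu).
apply: (@ty_Be _ _ 1) => //; first exact: ty_app_closed ty_isz hu.
by apply: IH; apply: ty_app_closed ty_decr hu.
Qed.

Lemma ty_any_of (T : Type) G D f (l : seq T) : distinct_vars G D ->
  (forall x, typing G D (f x) Boolean) -> typing G D (any_of f l) Boolean.
Proof.
move=> d hf; elim: l => [|x l IH] /=; first exact: ty_closed ty_B0i d.
by apply: (@ty_Be _ _ 0) => //; apply: ty_closed ty_B1i d.
Qed.

Lemma ty_all_of (T : Type) G D f (l : seq T) : distinct_vars G D ->
  (forall x, typing G D (f x) Boolean) -> typing G D (all_of f l) Boolean.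
Proof.
move=> d hf; elim: l => [|x l IH] /=; first exact: ty_closed ty_B1i d.
by apply: (@ty_Be _ _ 0) => //; apply: ty_closed ty_B0i d.
Qed.

Lemma ty_tmbool b : typing [::] [::] (tmbool b) Boolean.
Proof. by case: b; constructor. Qed.

Lemma ty_cell x b y p :
  x != y -> typing [::] [:: (y, Nat)] p Nat ->
  typing [::] [:: (x, Conf); (y, Nat)] (cell (Var x) b p) Nat.
Proof.
move=> xy hp; have d : distinct_vars [::] [:: (x, Conf); (y, Nat)].
  by rewrite /distinct_vars /= inE xy.
apply: (ty_lolli_e (G1 := [::]) (D1 := [:: _]) d _ hp).
by apply: (ty_app_to_closed (A := Boolean)) (ty_tmbool b); apply: ty_id.
Qed.

Lemma ty_next_conf s m : typing [::] [::] s Nat ->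
  typing [::] [:: (2, Conf)] (next_conf (Var 2) s m) Conf.
Proof.
move=> hs; apply: ty_lolli_i; apply: ty_lolli_i => /=.
set D := [:: _; _; _].
have h3 : typing [::] D (Var 3) (parn 0 Boolean) by apply: ty_var.
have h4 : typing [::] [:: (4, Nat)] (Var 4) Nat by apply: ty_id.
have hp : typing [::] [:: (4, Nat)] (App decr (Var 4)) Nat.
  exact: ty_app_closed ty_decr h4.
have hS : typing [::] [:: (4, Nat)] (App succ (Var 4)) Nat.
  exact: ty_app_closed ty_succ h4.
have up p A : typing [::] [:: (4, Nat)] p A -> typing [::] D p A.
  by move=> h; apply: ty_sub h _.
have hz p : typing [::] [:: (4, Nat)] p Nat ->
    typing [::] D (App isz p) (parn 1 Boolean).
  by move/up; apply: ty_app_closed ty_isz.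
have hc b p : typing [::] [:: (4, Nat)] p Nat ->
    typing [::] D (cell (Var 2) b p) Nat.
  by move=> h; apply: ty_sub (ty_cell b _ h) _.
have hs' : typing [::] D s Nat by apply: ty_closed hs _.
case: m; apply: (ty_Be h3); try exact: hc; apply: ty_Be (hz _ h4) _ _;
  try exact: hc; try exact: hs'.
by apply: ty_Be (hz _ hp) _ _; [exact: hs'|exact: hc].
Qed.

Lemma ty_step N : typing [::] [::] (step N) (Lolli Acc Acc).
Proof.
do 3!apply: ty_lolli_i => /=; set D := [:: _; _; _].
apply: ty_case_of => [|q]; first exact: ty_var.
apply: ty_case_of => [|s].
  apply: (@ty_sub [::] [:: (2, Conf)]) => //.
  apply: ty_app_to_closed ty_zero.
  by apply: (ty_app_to_closed (A := Boolean)) ty_B0i; apply: ty_id.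
have hcall (x : state N * symbol N * option bool) :
    typing [::] D (call (Var 0) (Var 2) x) Boolean.
  apply: (@ty_app [::] [:: (0, Acc)] [::] [:: (2, Conf)] Conf) => //.
    by apply: ty_app_to_closed (ty_cnum _); apply: ty_id.
  exact: ty_next_conf (ty_cnum _).
rewrite /verdict; case: (kind q).
- exact: ty_any_of.
- exact: ty_all_of.
- by apply: ty_closed ty_B1i _.
- by apply: ty_closed ty_B0i _.
Qed.

Lemma closed_step N : closed (step N).
Proof. exact: typing_closed (ty_step N). Qed.

Lemma sv_case_of (T : Type) w x u (l : seq T) g g' :
  (forall y, subst_var w x (g y) = g' y) ->
  subst_var w x (case_of u l g) = case_of (subst_var w x u) l g'.
Proof.
move=> hg; elim: l u => //= y l IH u.
by rewrite sv_If IH hg !svE !sv_constE.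
Qed.

Lemma sv_any_of (T : Type) w x f f' (l : seq T) :
  (forall y, subst_var w x (f y) = f' y) ->
  subst_var w x (any_of f l) = any_of f' l.
Proof. by move=> hf; elim: l => //= y l IH; rewrite sv_If IH hf. Qed.

Lemma sv_all_of (T : Type) w x f f' (l : seq T) :
  (forall y, subst_var w x (f y) = f' y) ->
  subst_var w x (all_of f l) = all_of f' l.
Proof. by move=> hf; elim: l => //= y l IH; rewrite sv_If IH hf. Qed.

Lemma sv_tmbool w x b : subst_var w x (tmbool b) = tmbool b.
Proof. by case: b. Qed.

Lemma sv_cell w x c b p :
  subst_var w x (cell c b p) = cell (subst_var w x c) b (subst_var w x p).
Proof. by rewrite /cell !svE sv_tmbool. Qed.

(** The bound on [x] keeps it apart from 3 and 4, which are bound in [next_conf]. *)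
Lemma sv_next_conf w x c s m : closed w -> x < 3 -> closed s ->
  subst_var w x (next_conf c s m) = next_conf (subst_var w x c) s m.
Proof.
move=> cw x3 cs; rewrite /next_conf !sv_abs //; try by case: x x3 => [|[|[]]].
do 2!congr abs.
by case: m; rewrite !(sv_constE, sv_cell, svE) ?[subst_var _ _ s]sv_closed //;
  case: x x3 => [|[|[]]].
Qed.

Lemma sv_step_body N w x a q c : closed w -> x < 3 ->
  subst_var w x (step_body N a q c) =
  step_body N (subst_var w x a) (subst_var w x q) (subst_var w x c).
Proof.
move=> cw x3; apply: sv_case_of => q'.
rewrite (@sv_case_of _ _ _ _ _ _
  (verdict (subst_var w x a) (subst_var w x c) q')).
  by rewrite sv_cell sv_constE.
move=> s; rewrite /verdict.
have hc (y : state N * symbol N * option bool) :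
    subst_var w x (call a c y) = call (subst_var w x a) (subst_var w x c) y.
  by rewrite /call !svE sv_next_conf ?closed_cnum // (sv_closed _ _ (closed_cnum _)).
by case: (kind q') => //; [apply: sv_any_of|apply: sv_all_of].
Qed.

Lemma reds_step N a q c v : closed a -> closed q -> closed c ->
  reds (step_body N a q c) v -> reds (App (App (App (step N) a) q) c) v.
Proof.
move=> ca cq cc; apply: reds_trans.
apply: (@reds_trans (App (App (abs 1 (abs 2 (step_body N a (Var 1) (Var 2)))) q) c)).
  do 2!apply: reds_App1; apply: reds_abs.
  by rewrite !sv_abs // sv_step_body // !svE; apply: reds_refl.
apply: (@reds_trans (App (abs 2 (step_body N a q (Var 2))) c)).
  apply: reds_App1; apply: reds_abs.
  by rewrite !sv_abs // sv_step_body // !svE (sv_closed _ _ ca); apply: reds_refl.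
apply: reds_abs.
rewrite sv_step_body // !svE (sv_closed _ _ ca) (sv_closed _ _ cq).
exact: reds_refl.
Qed.

Lemma reds_case_of (T : eqType) u (l : seq T) g x v :
  x \in l -> reds u (num (index x l)) -> reds (g x) v -> reds (case_of u l g) v.
Proof.
elim: l u => //= y l IH u; rewrite inE eq_sym.
case: eqP => [-> _ hu hv|_ /= xl hu hv].
  exact: reds_If (reds_isz hu) hv.
by apply: reds_If (reds_isz hu) _; apply: IH => //; apply: reds_decr hu.
Qed.

(** Acceptance is a proposition, so the boolean deciding it is produced together with the reduction
    that computes it. *)
Lemma reds_any_of (T : eqType) (P : T -> Prop) f (l : seq T) :
  (forall x, x \in l -> exists2 b : bool, P x <-> b & reds (f x) (tmbool b)) ->
  exists2 b : bool, (exists2 x, x \in l & P x) <-> b & reds (any_of f l) (tmbool b).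
Proof.
elim: l => [|x l IH] hl.
  by exists false; [split=> [[]|]|apply: reds_refl].
have [b Pb hb] := hl x (mem_head _ _).
have [y yl|b' Pb' hb'] := IH; first by apply: hl; rewrite inE yl orbT.
exists (b || b'); last by apply: reds_If hb _; case: (b) => //; apply: reds_refl.
split=> [[y]|/orP[/Pb Px|/Pb'[y yl Py]]].
- by rewrite inE => /predU1P[-> /Pb->//|yl Py]; apply/orP; right; apply/Pb'; exists y.
- by exists x; rewrite ?mem_head.
- by exists y; rewrite // inE yl orbT.
Qed.

Lemma reds_all_of (T : eqType) (P : T -> Prop) f (l : seq T) :
  (forall x, x \in l -> exists2 b : bool, P x <-> b & reds (f x) (tmbool b)) ->
  exists2 b : bool, (forall x, x \in l -> P x) <-> b & reds (all_of f l) (tmbool b).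
Proof.
elim: l => [|x l IH] hl.
  by exists true; [split|apply: reds_refl].
have [b Pb hb] := hl x (mem_head _ _).
have [y yl|b' Pb' hb'] := IH; first by apply: hl; rewrite inE yl orbT.
exists (b && b'); last by apply: reds_If hb _; case: (b) => //; apply: reds_refl.
split=> [h|/andP[/Pb Px /Pb' Pl] y].
  apply/andP; split; first by apply/Pb/h/mem_head.
  by apply/Pb' => y yl; apply: h; rewrite inE yl orbT.
by rewrite inE => /predU1P[->|/Pl].
Qed.

(** * Simulation *)

(** Positions are arbitrary terms reducing to a numeral, since [next_conf] passes them on
    unevaluated; unlisted cells read as blank. *)
Definition stacks_repr (N : atm) (C : term) (l r : seq (symbol N)) : Prop :=
  closed C /\ forall (b : bool) p n, reds p (num n) ->
    reds (cell C b p) (num (code (nth (blank N) (if b then l else r) n))).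

Definition conf_repr (N : atm) (C : term) (c : config N) : Prop :=
  stacks_repr C (cleft c) (cscan c :: cright c).

Lemma scoped_abs P x t :
  scoped (fun n => (n == x) || P n) t -> scoped P (abs x t).
Proof.
move=> h; apply: scoped_ren h => n.
by rewrite /bind_ren; case: eqP.
Qed.

Lemma closed_next_conf c s m : closed c -> closed s -> closed (next_conf c s m).
Proof.
move=> cc cs; apply/scoped_abs/scoped_abs.
by case: m => /=; rewrite !(closed_scoped _ cc) ?(closed_scoped _ cs)
  ?(closed_scoped _ closed_isz) ?(closed_scoped _ closed_decr)
  ?(closed_scoped _ closed_succ).
Qed.

Lemma reds_next_conf C s m b p v : closed C -> closed s ->
  reds (match m with
  | MoveLeft => if b then cell C true (App succ p) else
      If (App isz p) (cell C true p)
        (If (App isz (App decr p)) s (cell C false (App decr p)))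
  | MoveRight => if b then If (App isz p) s (cell C true (App decr p))
      else cell C false (App succ p)
  | Stay => if b then cell C true p else If (App isz p) s (cell C false p)
  end) v ->
  reds (cell (next_conf C s m) b p) v.
Proof.
move=> cC cs hv; rewrite {1}/cell /next_conf.
(* The body of [next_conf] with the side and the position as parameters: a single substitution law
   [tE] then covers all moves. *)
pose t m c b p := match m with
  | MoveLeft => If b (cell c true (App succ p))
      (If (App isz p) (cell c true p)
        (If (App isz (App decr p)) s (cell c false (App decr p))))
  | MoveRight => If b (If (App isz p) s (cell c true (App decr p)))
      (cell c false (App succ p))
  | Stay => If b (cell c true p) (If (App isz p) s (cell c false p))
  end.
have tE w x m' b' p' : subst_var w x (t m' C b' p') =
    t m' C (subst_var w x b') (subst_var w x p').
  by case: m'; rewrite /= !(sv_constE, sv_cell, svE) !(sv_closed _ _ cC)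
    ?(sv_closed _ _ cs).
apply: (@reds_trans (App (abs 4 (t m C (tmbool b) (Var 4))) p)).
  apply: reds_App1; apply: reds_abs.
  rewrite -/(t m C (Var 3) (Var 4)) sv_abs //; last by case: (b).
  by rewrite tE !svE; apply: reds_refl.
apply: reds_abs; rewrite tE sv_tmbool svE /=.
by case: m hv => /= hv; apply: (reds_If (reds_refl (tmbool b))).
Qed.

Lemma conf_repr_act (N : atm) C (c : config N) q s m : conf_repr C c ->
  conf_repr (next_conf C (cnum (code s)) m) (act c q s m).
Proof.
move=> [cC hC]; split; first exact: closed_next_conf (closed_cnum _).
move=> b p n hp; apply: reds_next_conf => //; first exact: closed_cnum.
have hs := reds_cnum (code s).
have hz := reds_isz hp; have hpr := reds_decr hp; have hsu := reds_succ hp.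
have hL := hC true; have hR := hC false.
(* Six goals: the left and then the right half of the tape, for each move in turn. *)
case: m => /=; case: b => /=.
- by rewrite nth_behead; apply: hL.
- apply: reds_If hz _; case: n hp hpr {hsu} => [|n] hp hpr /=.
    by have := hL _ _ hp; rewrite nth0.
  by apply: reds_If (reds_isz hpr) _; case: n hp hpr => [|n] hp hpr //=; apply: hR hpr.
- by apply: reds_If hz _; case: n hp hpr {hsu} => [|n] hp hpr //=; apply: hL hpr.
- case: n hp hpr hsu {hz} => [|n] hp hpr hsu /=.
    by have := hR _ _ hsu; rewrite /= nth0.
  by have := hR _ _ hsu; rewrite /= nth_behead.
- exact: hL.
- by apply: reds_If hz _; case: n hp hpr {hsu} => [|n] hp hpr //=; apply: hR hp.
Qed.

(** The inequality is strict, so that no configuration is bounded by 0 and the induction on [t] has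
    a vacuous base. *)
Definition bounded (N : atm) (t : nat) (c : config N) : Prop :=
  forall k c', atm_steps k c c' -> k < t.

Definition decides (N : atm) (a : term) (t : nat) : Prop :=
  forall (c : config N) C q, bounded t c -> conf_repr C c ->
    closed q -> reds q (num (code (cstate c))) ->
    exists2 b : bool, accepting c <-> b & reds (App (App a q) C) (tmbool b).

Lemma atm_stepE (N : atm) (c c' : config N) :
  halting_kind (kind (cstate c)) = false ->
  atm_step c c' <-> exists2 x, x \in succs (cstate c) (cscan c) &
                               c' = act c x.1.1 x.1.2 (move_of x.2).
Proof.
move=> hk; split=> [[q s m _ hd]|[x]].
  pose o := match m with MoveLeft => Some true | MoveRight => Some false
            | Stay => None end.
  have om : move_of o = m by rewrite /o; case: (m).
  by exists (q, s, o); rewrite /= ?om // mem_filter mem_enum /= om hd.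
by rewrite mem_filter => /andP[hd _] ->; constructor.
Qed.

(** A successor of a configuration bounded by [t.+1] is bounded by [t], so [a] answers correctly on
    it; the kind of the state then tells how to combine the answers. *)
Lemma decides_step (N : atm) a t : closed a -> decides N a t ->
  decides N (App (step N) a) t.+1.
Proof.
move=> ca ha c C q hb hC cq hq.
have [cC hC2] := hC.
suff [b hb1 hb2] : exists2 b : bool, accepting c <-> b &
    reds (verdict a C (cstate c) (cscan c)) (tmbool b).
  exists b => //; apply: reds_step => //.
  apply: (@reds_case_of _ _ _ _ (cstate c)); rewrite ?mem_enum //.
  apply: (@reds_case_of _ _ _ _ (cscan c)); rewrite ?mem_enum //.
  (* Right cell 0 is the scanned cell, and [zero] computes to [num 0]. *)
  exact: (hC2 false zero 0 (reds_refl _)).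
have hcall x : halting_kind (kind (cstate c)) = false ->
    x \in succs (cstate c) (cscan c) ->
    exists2 b : bool, accepting (act c x.1.1 x.1.2 (move_of x.2)) <-> b &
      reds (call a C x) (tmbool b).
  move=> hk xs; apply: ha.
  - move=> k c' hk'; rewrite -ltnS; apply: hb.
    apply: atm_stepsS hk'; apply/atm_stepE => //; by exists x.
  - exact: conf_repr_act.
  - exact: closed_cnum.
  - by case: (move_of x.2); apply: reds_cnum.
rewrite /verdict; case hk: (kind (cstate c)) hcall => /= hcall.
- have [b hb1 hb2] := reds_any_of (fun x => hcall x erefl).
  exists b => //; apply: iff_trans hb1; split.
  + case=> [|c' _ /atm_stepE|]; rewrite ?hk //.
    by case=> // x xs -> hx; exists x.
  + case=> x xs hx; apply: (accepting_exists hk _ hx).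
    by apply/atm_stepE; rewrite ?hk //; exists x.
- have [b hb1 hb2] := reds_all_of (fun x => hcall x erefl).
  exists b => //; apply: iff_trans hb1; split.
  + case=> [||_ h x xs]; rewrite ?hk //.
    by apply: h; apply/atm_stepE; rewrite ?hk //; exists x.
  + move=> h; apply: (accepting_forall hk) => c' /atm_stepE[]; first by rewrite hk.
    by move=> x xs ->; apply: h.
- exists true; last exact: reds_refl.
  by split=> // _; apply: accepting_halt.
- exists false; last exact: reds_refl.
  by split=> //; case; rewrite hk.
Qed.

Lemma decides_iter (N : atm) n a t : closed a -> decides N a t ->
  decides N (iter n (App (step N)) a) (n + t).
Proof.
move=> ca ha; elim: n => //= n IH.
by apply: decides_step IH; apply: closed_iter (closed_step N) ca.
Qed.

(** * The initial configuration *)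

Definition tape_nil (N : atm) : term := abs 3 (abs 4 (cnum (code (blank N)))).

Definition tape_cons (N : atm) (b : bool) : term :=
  abs 0 (abs 3 (abs 4 (If (Var 3) (cell (Var 0) true (Var 4))
    (If (App isz (Var 4)) (cnum (code (letter N b)))
      (cell (Var 0) false (App decr (Var 4))))))).

Lemma ty_tape_nil N : typing [::] [::] (tape_nil N) Conf.
Proof.
do 2!apply: ty_lolli_i => /=.
by apply: ty_closed (ty_cnum _) _.
Qed.

Lemma ty_tape_cons N b : typing [::] [::] (tape_cons N b) (Lolli Conf Conf).
Proof.
do 3!apply: ty_lolli_i => /=; set D := [:: _; _; _].
have h4 : typing [::] [:: (4, Nat)] (Var 4) Nat by apply: ty_id.
apply: (@ty_Be _ _ 0); first exact: ty_var.
  exact: ty_sub (ty_cell (x := 0) true _ h4) _.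
apply: (@ty_Be _ _ 1).
- by apply: ty_app_closed ty_isz _; apply: ty_var.
- by apply: ty_closed (ty_cnum _) _.
apply: ty_sub (ty_cell (x := 0) (y := 4) false _ _) _ => //.
exact: ty_app_closed ty_decr h4.
Qed.

Lemma stacks_repr_tape (N : atm) w :
  stacks_repr (wfold (tape_cons N false) (tape_cons N true) (tape_nil N) w)
    [::] (map (@letter N) w).
Proof.
elim: w => [|b w [cC hC]] /=.
  split=> [|b p n _]; first exact: typing_closed (ty_tape_nil N).
  rewrite if_same nth_nil.
  apply: reds_trans (reds_cnum _).
  apply: (@reds_trans (App (abs 4 (cnum (code (blank N)))) p)).
    apply/reds_App1/reds_abs; rewrite sv_abs //; last by case: (b).
    by rewrite (sv_closed _ _ (closed_cnum _)); apply: reds_refl.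
  by apply: reds_abs; rewrite (sv_closed _ _ (closed_cnum _)); apply: reds_refl.
set C := wfold _ _ _ w in cC hC *.
have -> : (if b then tape_cons N true else tape_cons N false) = tape_cons N b.
  by case: b.
split=> [|left p n hp].
  exact/andP/(conj (typing_closed (ty_tape_cons N b)) cC).
pose t := If (tmbool left) (cell C true p)
    (If (App isz p) (cnum (code (letter N b))) (cell C false (App decr p))).
apply: (@reds_trans t).
  apply: (@reds_trans (App (App (abs 3 (abs 4 (If (Var 3) (cell C true (Var 4))
    (If (App isz (Var 4)) (cnum (code (letter N b)))
      (cell C false (App decr (Var 4))))))) (tmbool left)) p)).
    do 2!apply: reds_App1; apply: reds_abs; rewrite !sv_abs //.
    rewrite !(sv_constE, sv_cell, svE) (sv_closed _ _ (closed_cnum _)) /=.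
    exact: reds_refl.
  apply: (@reds_trans (App (abs 4 (If (tmbool left) (cell C true (Var 4))
    (If (App isz (Var 4)) (cnum (code (letter N b)))
      (cell C false (App decr (Var 4)))))) p)).
    apply: reds_App1; apply: reds_abs; rewrite sv_abs //; last by case: (left).
    rewrite !(sv_constE, sv_cell, svE) (sv_closed _ _ (closed_cnum _)) /=.
    by rewrite !(sv_closed _ _ cC); apply: reds_refl.
  apply: reds_abs.
  rewrite !(sv_constE, sv_cell, svE) (sv_closed _ _ (closed_cnum _)) /=.
  by rewrite sv_tmbool !(sv_closed _ _ cC); apply: reds_refl.
apply: reds_If (reds_refl _) _; case: left @t.
  exact: (hC true).
apply: reds_If (reds_isz hp) _; case: n hp => [|n] hp /=; first exact: reds_cnum.
exact: (hC false _ _ (reds_decr hp)).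
Qed.

Lemma conf_repr_init (N : atm) w :
  conf_repr (wfold (tape_cons N false) (tape_cons N true) (tape_nil N) w)
    (init_config N w).
Proof.
have [cC hC] := stacks_repr_tape N w.
split=> // b p n hp; have := hC b p n hp.
case: b; case: w {cC hC} => [|b w] //=.
(* For the empty word the right half lists one blank, the scanned cell, instead of nothing; both
   read as blank everywhere. *)
by case: n {hp} => [|n] /=; rewrite ?nth_nil.
Qed.

(** * Running the machine against a clock *)

Definition reject : term := abs 0 (abs 1 tmF).

Lemma ty_reject : typing [::] [::] reject Acc.
Proof. by do 2!apply: ty_lolli_i => /=; apply: ty_closed ty_B0i _. Qed.

Lemma decides_reject N : decides N reject 0.
Proof. by move=> c C q /(_ _ _ (atm_steps0 c)). Qed.

(** Starting from [App (step N) reject] makes [n.+1] steps in total: computations of length at most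
    [n] are those of length below [n.+1]. *)
Definition run_body (N : atm) (n w : term) : term :=
  App (App (App (App n (step N)) (App (step N) reject)) (cnum (code (start N))))
      (App (App (App w (tape_cons N false)) (tape_cons N true)) (tape_nil N)).

Definition run (N : atm) : term := abs 0 (abs 1 (run_body N (Var 0) (Var 1))).

Lemma sv_run_body N u x n w :
  subst_var u x (run_body N n w) =
  run_body N (subst_var u x n) (subst_var u x w).
Proof.
rewrite /run_body !svE !(sv_closed _ _ (closed_step N)).
rewrite !(sv_closed _ _ (typing_closed (ty_tape_cons N _))).
rewrite (sv_closed _ _ (typing_closed (ty_tape_nil N))).
by rewrite (sv_closed _ _ (closed_cnum _)) (sv_closed _ _ (typing_closed ty_reject)).
Qed.

(** The iterated step and the tape built from the word are both opened by §-elimination and combined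
    under the same §, so the two iterations cost a single one. *)
Lemma ty_run N : typing [::] [::] (run N) (Lolli Nat (Lolli W (Par Boolean))).
Proof.
do 2!apply: ty_lolli_i => /=.
pose tape x := App (App (App x (tape_cons N false)) (tape_cons N true)) (tape_nil N).
pose acc x := App (App x (App (step N) reject)) (cnum (code (start N))).
apply: (@ty_par_let 7 (App (Var 0) (step N)) (App (acc (Var 7)) (tape (Var 1)))
  (Lolli Acc Acc) [::] [:: (0, Nat)] [::] [:: (1, W)]) => //.
- apply: ty_arrow_e0 (ty_step N); exact/ty_Nat_e/ty_id.
- apply: (@ty_par_let 8 (App (App (Var 1) (tape_cons N false)) (tape_cons N true))
    (App (acc (Var 7)) (App (Var 8) (tape_nil N)))
    (Lolli Conf Conf) [::] [:: (1, W)] [::] [:: (7, Par (Lolli Acc Acc))]) => //.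
  + apply: ty_arrow_e0 (ty_tape_cons _ _); apply: ty_arrow_e0 (ty_tape_cons _ _).
    exact/ty_W_e/ty_id.
  + apply: (@ty_par_i [::] [:: (8, Lolli Conf Conf); (7, Lolli Acc Acc)]).
    apply: (@ty_app [::] [:: (7, Lolli Acc Acc)] [::] [:: (8, Lolli Conf Conf)] Conf) => //.
      apply: ty_app_to_closed (ty_cnum _).
      apply: (@ty_app_to_closed Acc); first exact: ty_id.
      exact: ty_app_closed (ty_step N) ty_reject.
    by apply: ty_app_to_closed (ty_tape_nil N); apply: ty_id.
  + by rewrite /acc /tape !svE !(sv_closed _ _ (closed_step N))
     (sv_closed _ _ (closed_cnum _)) (sv_closed _ _ (typing_closed ty_reject))
     (sv_closed _ _ (typing_closed (ty_tape_nil N))).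
by rewrite /acc /tape !svE !(sv_closed _ _ (closed_step N))
   (sv_closed _ _ (closed_cnum _)) (sv_closed _ _ (typing_closed ty_reject))
   (sv_closed _ _ (typing_closed (ty_tape_nil N)))
   !(sv_closed _ _ (typing_closed (ty_tape_cons N _))).
Qed.

Lemma reds_run (N : atm) t n u w :
  reds t (num n) -> reds u (word w) -> bounded n.+1 (init_config N w) ->
  exists2 b : bool, accepting (init_config N w) <-> b &
    reds (App (App (run N) t) u) (tmbool b).
Proof.
move=> ht hu hb.
have cr := typing_closed ty_reject.
have c1 : closed (App (step N) reject) by apply/andP/(conj (closed_step N)).
have h1 := decides_iter (n := n) c1 (decides_step cr (@decides_reject N)).
rewrite addn1 in h1.
have [b hacc hred] := h1 _ _ _ hb (conf_repr_init N w) (closed_cnum _) (reds_cnum _).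
exists b => //; apply: reds_trans (reds_App (reds_App2 _ ht) hu) _.
apply: (@reds_trans (run_body N (num n) (word w))).
  apply: (@reds_trans (App (abs 1 (run_body N (num n) (Var 1))) (word w))).
    apply: reds_App1; apply: reds_abs.
    by rewrite sv_abs ?closed_num // sv_run_body !svE; apply: reds_refl.
  apply: reds_abs; rewrite sv_run_body !svE (sv_closed _ _ (closed_num n)).
  exact: reds_refl.
apply: reds_trans hred; apply: reds_App; last exact/reds_word/reds_refl.
exact/reds_App1/reds_num/reds_refl.
Qed.

(** * The complete program and its type *)

Definition program (N : atm) (d : nat) : term :=
  abs 0 (App (App (run N) (iter d (App square) (App len (Var 0))))
             (iter (2 * d) (App lift_word) (Var 0))).

Lemma parnD m n A : parn (m + n) A = parn m (parn n A).
Proof. exact: iterD. Qed.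

Lemma ty_iter_square d G D t : typing G D t Nat ->
  typing G D (iter d (App square) t) (parn (2 * d) Nat).
Proof.
move=> ht; elim: d => [//|d /(ty_par_map ty_square)].
by rewrite mulnS addnC parnD.
Qed.

Lemma ty_iter_lift_word k G D t : typing G D t W ->
  typing G D (iter k (App lift_word) t) (parn k W).
Proof.
move=> ht; elim: k => [//|k /(ty_par_map ty_lift_word)].
by rewrite -addn1 parnD addn1.
Qed.

(** The clock comes at depth [2 * d] from the squarings, and [lift_word] brings the tape to the same
    depth. Applying [run] there adds one §; the last one comes from §-introduction, which makes both
    copies of the input non-linear so that they can be contracted. *)
Lemma ty_program N d :
  typing [::] [::] (program N d) (Arrow W (parn (2 * d + 2) Boolean)).
Proof.
apply: ty_arrow_i => /=; rewrite addnS.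
apply: (@ty_contract 5 6
  (App (App (run N) (iter d (App square) (App len (Var 5))))
       (iter (2 * d) (App lift_word) (Var 6)))) => //.
  apply: (@ty_par_i [:: (5, W); (6, W)] [::] _ (parn (2 * d + 1) Boolean)).
  rewrite parnD.
  apply: ty_par_map2 (ty_run N) _ _ => //.
    by apply: ty_iter_square; apply: ty_app_closed ty_len _; apply: ty_id.
  by apply: ty_iter_lift_word; apply: ty_id.
move: (run N) (typing_closed (ty_run N)) => r cr.
by rewrite /merge_var /= !ren_iter (ren_closed _ cr).
Qed.

Lemma reds_iter_square d t n : reds t (num n) ->
  reds (iter d (App square) t) (num (n ^ (2 ^ d))).
Proof.
move=> ht; elim: d => [|d /reds_square] /=; first by rewrite expn1.
by rewrite -expnM -expnSr.
Qed.

Lemma reds_iter_lift_word k t w : reds t (word w) ->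
  reds (iter k (App lift_word) t) (word w).
Proof. by move=> ht; elim: k => //= k /reds_lift_word. Qed.

Lemma normal_tmbool b : normal (tmbool b).
Proof.
move=> u h; case: b h => /= h; inversion h as [? ? r| | | | | | ]; inversion r.
Qed.

Theorem theorem8 (f : seq bool -> bool) (d : nat)
  (hf : exists N : atm, computes_in_time N f (fun n => n ^ (2 ^ d))) :
  exists M : term,
    typing [::] [::] M (Arrow W (parn (2 * d + 2) Boolean)) /\
    represents M f.
Proof.
have [N hN] := hf; exists (program N d); split; first exact: ty_program.
move=> w; have [htime hacc] := hN w; split; last exact: normal_tmbool.
apply: reds_abs; rewrite !svE (sv_closed _ _ (typing_closed (ty_run N))).
rewrite /subst_var !subst_iter.
have hlen := reds_len (reds_refl (word w)).
(* The time bound [htime] is already of the form [bounded], because [k <= n] and [k < n.+1] are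
   convertible. *)
have [b hb hred] := reds_run (reds_iter_square d hlen)
  (reds_iter_lift_word (2 * d) (reds_refl (word w))) htime.
suff -> : f w = b by [].
by apply/idP/idP => h; [apply/hb/hacc|apply/hacc/hb].
Qed.
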